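(* There exist infinitely many (pairwise non-isomorphic) $6$-connected $1$-plane graphs that have no $3$-connected spanning plane subgraphs.
   Context: All graphs are finite, simple and undirected. A (plane) drawing of a graph represents the vertices by distinct points of the plane and the edges by non-self-intersecting arcs joining the points of their end vertices and containing no vertex point in their interior. A $1$-plane graph is a graph given together with a plane drawing in which each edge is crossed at most once by another edge, i.e. each edge has at most one crossing point; crossings of adjacent edges are forbidden. A spanning plane subgraph of a $1$-plane graph $G$ is a subgraph $F$ with $V(F)=V(G)$ that is a plane graph with respect to the given drawing of $G$, i.e. no two edges of $F$ cross in that drawing. The connectivity is $\kappa(G)=\min\{p(u,v) : u,v\in V(G), u\neq v\}$, where $p(u,v)$ is the maximum number of pairwise internally vertex-disjoint $uv$-paths; $G$ is $k$-connected if $\kappa(G)\ge k$. *)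

(* Defs.v *)
(* MathComp / MathComp-Analysis. *)
From mathcomp Require Import all_boot all_order all_algebra.
From mathcomp Require Import all_classical all_reals all_analysis.

Set Implicit Arguments.
Unset Strict Implicit.
Unset Printing Implicit Defensive.

Import Order.TTheory GRing.Theory Num.Theory.
Import numFieldNormedType.Exports.

Record sgraph := SGraph {
  svertex :> finType;
  adj : rel svertex;
  adj_sym : symmetric adj;
  adj_irrefl : irreflexive adj }.

Definition isomorphic (G H : sgraph) : Prop :=
  exists f : G -> H, bijective f /\ forall u v, adj (f u) (f v) = adj u v.

Definition edge_ends (G : sgraph) (u v : G) : {set G} := [set u; v]%SET.

Definition disjoint_edges (G : sgraph) (u v x y : G) : bool :=
  [disjoint edge_ends u v & edge_ends x y].

Section Connectivity.
Variables (V : finType) (e : rel V).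

(* A uv-path (u != v) is represented by the sequence of its internal vertices;
   since these are distinct, a sequence of length at most #|V| always suffices. *)
Definition is_uvpath (u v : V) (s : seq V) : bool :=
  path e u (rcons s v) && uniq (u :: rcons s v).

Definition internally_disjoint (P : {set #|V|.-bseq V}) : bool :=
  [forall s in P, forall t in P, (s != t) ==> [disjoint s & t]].

Definition local_connectivity (u v : V) : nat :=
  \max_(P : {set #|V|.-bseq V} |
          [forall s in P, is_uvpath u v s] && internally_disjoint P) #|P|.

(* The local connectivity never exceeds #|V|.-1, so the initial value of the
   minimum only matters when #|V| <= 1, where it gives connectivity 0. *)
Definition connectivity : nat :=
  \big[minn/#|V|.-1]_(uv : V * V | uv.1 != uv.2) local_connectivity uv.1 uv.2.

Definition k_connected (k : nat) : Prop := (k <= connectivity)%N.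

End Connectivity.

Local Open Scope classical_set_scope.
Local Open Scope ring_scope.

Section Drawings.
Variable R : realType.

Local Notation plane := (R * R)%type.

Definition is_arc (A : set plane) (a b : plane) : Prop :=
  exists gamma : R -> plane,
    [/\ {within `[0, 1], continuous gamma},
        {in `[0, 1] &, injective gamma},
        gamma 0 = a, gamma 1 = b & A = gamma @` `[0, 1]].

(* Near p, the pair (A, B) is homeomorphic to the two coordinate axes near
   the origin: A and B cross properly at p, as opposed to touching there. *)
Definition cross_at (A B : set plane) (p : plane) : Prop :=
  exists (U : set plane) (h k : plane -> plane),
    [/\ open U /\ U p,
        open (h @` U),
        [/\ {within U, continuous h}, {within h @` U, continuous k}
          & forall q, U q -> k (h q) = q],
        h p = (0, 0)
      & forall q, U q -> (A q <-> (h q).2 = 0) /\ (B q <-> (h q).1 = 0)].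

(* The values of [edge_arc] on non-adjacent pairs are irrelevant. *)
Record layout (G : sgraph) := Layout {
  vertex_point : G -> plane;
  edge_arc : G -> G -> set plane }.

Section Layout.
Variables (G : sgraph) (D : layout G).

Definition edge_interior (u v : G) : set plane :=
  edge_arc D u v `\` [set vertex_point D u; vertex_point D v].

Definition crossing_point (u v x y : G) (p : plane) : Prop :=
  [/\ adj u v, adj x y, edge_ends u v <> edge_ends x y,
      edge_interior u v p & edge_interior x y p].

(* Edges may meet in their interiors only by crossing, never by touching. *)
Definition is_drawing : Prop :=
  [/\ injective (vertex_point D),
      forall u v, adj u v -> edge_arc D u v = edge_arc D v u,
      forall u v, adj u v -> is_arc (edge_arc D u v) (vertex_point D u) (vertex_point D v),
      forall u v w, adj u v -> ~ edge_interior u v (vertex_point D w)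
    & forall u v x y p, crossing_point u v x y p ->
        cross_at (edge_arc D u v) (edge_arc D x y) p].

Definition crossed_at_most_once : Prop :=
  forall u v x y x' y' p p',
    crossing_point u v x y p -> crossing_point u v x' y' p' ->
    edge_ends x y = edge_ends x' y' /\ p = p'.

Definition no_adjacent_crossing : Prop :=
  forall u v x y p, crossing_point u v x y p ->
    disjoint_edges u v x y.

Definition is_one_plane : Prop :=
  [/\ is_drawing, crossed_at_most_once & no_adjacent_crossing].

Definition spanning_plane_subgraph (F : rel G) : Prop :=
  [/\ symmetric F, subrel F (@adj G)
    & forall u v x y p, F u v -> F x y -> ~ crossing_point u v x y p].

End Layout.

Record one_plane_graph := OnePlaneGraph {
  opg_graph :> sgraph;
  opg_layout : layout opg_graph;
  opg_one_plane : is_one_plane opg_layout }.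

End Drawings.

(* Main.v *)
(* Nine clusters are joined by 15 pairs of crossing edges. A cluster consists of
   a hub and m+2 concentric hexagons with both diagonals in every quadrangle
   between two consecutive hexagons; the edges leaving it start at its six outer
   corners.

   6-connectivity: at most four vertices do not disconnect a cluster, at most
   five do not separate any vertex of it from its outer corners, and every
   bipartition of the set of clusters is crossed by a matching of six edges.
   Menger's theorem, which follows from Hall's, then applies.

   No 3-connected spanning plane subgraph F: at least three of the edges leaving
   each cluster belong to F, and at most one edge of each crossing pair. In seven
   clusters exactly six edges leave; four of them form two pairs of edges that
   cross each other and join the same two clusters, so one of the remaining two
   edges is in F. The remaining edges form five crossing pairs, so these are seven
   2-clauses in five variables, of the form
     a \/ d, ~d \/ c, c \/ ~a, ~c \/ ~b, ~a \/ e, ~e \/ b, b \/ a,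
   and they are unsatisfiable: if c then ~b, so a and ~e, hence ~a; if ~c then
   ~d, so a and ~a.

   The drawing is straight-line with integer coordinates, obtained by rounding a
   Tutte embedding of the plane graph formed by the outer hexagons and the convex
   hulls of the crossing pairs. Edges which do not cross are separated by a line. *)

Require Import Defs.
From mathcomp Require Import all_boot all_order all_algebra.
From mathcomp Require Import zify.

Set Implicit Arguments.
Unset Strict Implicit.
Unset Printing Implicit Defensive.

Import GRing.Theory.

(** * Menger's theorem *)

(** Induction on the size of the set [D] still to be matched. If some nonempty proper subset [X] is
    tight, it is matched first and the rest outside its neighbourhood. Otherwise every such subset
    has a neighbour to spare, and an arbitrary single pair can be fixed. [r0] is the value of the
    constant function that starts the induction. *)
Lemma hall_marriage (L R : finType) (N : L -> {set R}) (r0 : R) :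
  (forall X : {set L}, #|X| <= #|\bigcup_(x in X) N x|) ->
  exists2 f : L -> R, injective f & forall x, f x \in N x.
Proof.
move=> hallT.
suff: forall D : {set L},
    (forall X : {set L}, X \subset D -> #|X| <= #|\bigcup_(x in X) N x|) ->
    exists2 f : L -> R, {in D &, injective f} & {in D, forall x, f x \in N x}.
  case/(_ [set: L]) => [X _|f fI fN]; first exact: hallT.
  by exists f => [x y|x]; [apply: fI; rewrite inE | apply: fN; rewrite inE].
move=> D; move: {2}#|D| (leqnn #|D|) => n; elim: n N D {hallT} => [|n IH] N D.
  rewrite leqn0 cards_eq0 => /eqP-> _.
  by exists (fun=> r0) => x; rewrite inE.
move=> leDn hall.
(* The step common to both cases: a matching of [X] into [Y] is completed by one of [D :\: X] that
   avoids [Y]. *)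
have glue (X : {set L}) (Y : {set R}) (g : L -> R) :
    X \subset D -> X != set0 -> {in X &, injective g} ->
    {in X, forall x, g x \in N x :&: Y} ->
    (forall Z : {set L}, Z \subset D :\: X ->
       #|Z| <= #|\bigcup_(x in Z) (N x :\: Y)|) ->
    exists2 f : L -> R, {in D &, injective f} & {in D, forall x, f x \in N x}.
  move=> sXD nX gI gN hallZ.
  have [|h hI hN] := IH (fun x => N x :\: Y) (D :\: X) _ hallZ.
    rewrite -ltnS (leq_trans _ leDn) // cardsD (setIidPr sXD).
    by rewrite ltn_subrL !card_gt0 nX (subset_neq0 sXD nX).
  exists (fun x => if x \in X then g x else h x) => [x y|x] xD; last first.
    case: ifPn => [/gN|nxX]; first by case/setIP.
    have xDX : x \in D :\: X by rewrite inE nxX.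
    by have /setDP[] := hN x xDX.
  move=> yD; case: ifPn => xX; case: ifPn => yX //; first exact: gI.
  - move=> eq; have := hN y _; rewrite !inE yX yD -eq => /(_ isT).
    by have := gN x xX; rewrite inE => /andP[_ ->].
  - move=> eq; have := hN x _; rewrite !inE xX xD eq => /(_ isT).
    by have := gN y yX; rewrite inE => /andP[_ ->].
  by apply: hI; rewrite inE ?xX ?yX.
have bigD (Z : {set L}) (Y : {set R}) :
    \bigcup_(x in Z) (N x :\: Y) = (\bigcup_(x in Z) N x) :\: Y.
  apply/setP=> y; rewrite inE; apply/bigcupP/andP.
    by case=> x xZ /setDP[yN yY]; split=> //; apply/bigcupP; exists x.
  by case=> yY /bigcupP[x xZ yN]; exists x => //; rewrite inE yY.
have [D0|[x0 x0D]] := set_0Vmem D.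
  by exists (fun=> r0) => x; rewrite D0 inE.
case: (boolP [exists X : {set L}, [&& X \proper D, X != set0
         & #|\bigcup_(x in X) N x| <= #|X|]]).
  case/existsP=> X /and3P[prXD nX tight].
  have sXD := proper_sub prXD.
  have [|Z sZX|g gI gN] := IH N X.
  - by rewrite -ltnS (leq_trans (proper_card prXD)).
  - by apply: hall; apply: subset_trans sXD.
  apply: (glue X (\bigcup_(x in X) N x) g) => // [x xX|Z sZ].
    by rewrite inE gN //=; apply/bigcupP; exists x; rewrite ?gN.
  (* Since [X] is tight, adding its neighbourhood to both sides reduces the claim to Hall's
     condition for [Z :|: X]. *)
  rewrite bigD -(leq_add2r #|\bigcup_(x in X) N x|) -cardsUI.
  have -> : (\bigcup_(x in Z) N x :\: \bigcup_(x in X) N x) :&: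
            (\bigcup_(x in X) N x) = set0.
    by apply/setP=> y; rewrite !inE andbAC andNb.
  rewrite cards0 addn0.
  have -> : (\bigcup_(x in Z) N x :\: \bigcup_(x in X) N x) :|:
            (\bigcup_(x in X) N x) = \bigcup_(x in Z :|: X) N x.
    rewrite bigcup_setU; apply/setP=> y; rewrite !inE.
    by case: (y \in \bigcup_(x in X) N x); rewrite ?orbT ?orbF.
  have dZX : Z :&: X = set0.
    by apply/setP=> y; rewrite !inE; apply/negP=> /andP[/(subsetP sZ)/setDP[_ /negP]].
  apply: leq_trans (_ : #|Z :|: X| <= _).
    by rewrite cardsU dZX cards0 subn0 leq_add2l.
  apply: hall.
  by rewrite subUset sXD andbT (subset_trans sZ) // subsetDl.
rewrite negb_exists => /forallP noTight.
have [y yN] : exists y, y \in N x0.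
  apply/set0Pn; rewrite -card_gt0.
  have := hall [set x0]; rewrite sub1set cards1 => /(_ x0D).
  by rewrite big_set1.
apply: (glue [set x0] [set y] (fun=> y)).
- by rewrite sub1set.
- by apply/set0Pn; exists x0; rewrite inE.
- by move=> a b /set1P-> /set1P->.
- by move=> a /set1P->; rewrite !inE yN eqxx.
move=> Z sZ; rewrite bigD.
have [->|nZ] := eqVneq Z set0; first by rewrite cards0.
have prZ : Z \proper D.
  rewrite properE (subset_trans sZ (subsetDl _ _)) /=.
  by apply/negP=> /subsetP/(_ _ x0D)/(subsetP sZ); rewrite !inE eqxx.
(* As [Z] is not tight, it has more than [#|Z|] neighbours and can lose [y]. *)
have := noTight Z; rewrite prZ nZ /= -ltnNge => lt.
have := cardsD1 y (\bigcup_(x in Z) N x).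
by move: lt; case: (y \in _) => /=; lia.
Qed.

(** * From Hall's condition to internally disjoint paths *)

Section Menger.
Variables (V : finType) (e : rel V).
Hypotheses (e_sym : symmetric e) (e_irr : irreflexive e).

Definition nbhd (A : {set V}) : {set V} := [set y | [exists x in A, e x y]].

Definition boundary (A : {set V}) : {set V} := nbhd A :\: A.

Lemma mem_nbhd (A : {set V}) x y : x \in A -> e x y -> y \in nbhd A.
Proof. by move=> xA xy; rewrite inE; apply/exists_inP; exists x. Qed.

Section Linkage.
Variables (k : nat) (u v : V).
Hypothesis neq_uv : u != v.

(* In a bijection from ['I_k + V] to itself compatible with this relation, the
   orbits of the [k] tokens [inl i] are internally disjoint [uv]-paths: a token
   stands for [u] on the left-hand side and for [v] on the right-hand side. *)
Definition link_rel (x y : 'I_k.+1 + V) : bool :=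
  match x, y with
  | inl _, inl j => e u v && (j == ord0)
  | inl _, inr w => e u w && (w != v)
  | inr w, inl _ => [&& w != u, w != v & e w v]
  | inr w, inr z => (w == z) || [&& e w z, w != u, w != v, z != u & z != v]
  end.

Definition link_nbhd (x : 'I_k.+1 + V) : {set 'I_k.+1 + V} := [set y | link_rel x y].

(** No vertex of [X] is adjacent to [v], so the boundary of [u |: X] consists of vertices counted
    here and possibly [v], the latter only if [uv] is an edge. If the closed neighbourhood of
    [u |: X] is everything, [uv] is an edge. Then the order of the graph gives the bound for empty
    [X], and otherwise the boundary of [v] does, which misses [X]. *)
Lemma boundary_bound (X : {set V}) :
  (forall A : {set V}, A != set0 -> A :|: nbhd A != [set: V] -> k < #|boundary A|) ->
  k.+1 < #|V| -> (forall w, w \in X -> [&& w != u, w != v & ~~ e w v]) ->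
  k < #|nbhd (u |: X) :\: (X :|: [set u; v])| + e u v.
Proof.
move=> cut Vk Xuv; set S := _ :\: _.
have bdS : boundary (u |: X) \subset S :|: (if e u v then [set v] else set0).
  apply/subsetP=> w; rewrite in_setD => /andP[wuX wN].
  rewrite in_setU in_setD wN andbT !inE; move: wuX; rewrite !inE negb_or => /andP[/negPf-> /negPf->] /=.
  have [wv|//] := eqVneq w v; rewrite wv in wN *.
  rewrite /=; case: ifP => [_|]; first by rewrite set11.
  move: wN; rewrite inE => /exists_inP[z]; rewrite !inE => /orP[/eqP->->//|/Xuv].
  by case/and3P=> _ _ /negPf->.
have bdc : #|boundary (u |: X)| <= #|S| + e u v.
  apply: leq_trans (subset_leq_card bdS) _; apply: leq_trans (leq_card_setU _ _) _.
  by rewrite leq_add2l; case: ifP; rewrite ?cards1 ?cards0.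
have nuX : u |: X != set0 by apply/set0Pn; exists u; rewrite !inE eqxx.
have [full|nfull] := eqVneq (u |: X :|: nbhd (u |: X)) [set: V]; last first.
  by apply: leq_trans (cut _ nuX nfull) bdc.
have vX : v \notin X by apply/negP=> /Xuv; rewrite eqxx andbF.
have euv : e u v.
  have : v \in u |: X :|: nbhd (u |: X) by rewrite full inE.
  rewrite !inE (negPf vX) eq_sym (negPf neq_uv) /= => /exists_inP[z].
  by rewrite !inE => /orP[/eqP->//|/Xuv/and3P[_ _ /negPf->]].
have fullS : [set: V] \subset u |: X :|: boundary (u |: X).
  apply/subsetP=> w _; have : w \in u |: X :|: nbhd (u |: X) by rewrite full inE.
  rewrite !in_setU in_setD in_setU; case: (w \in [set u]) => //=.
  by case: (w \in X).
rewrite euv addn1 ltnS.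
have [X0|[x xX]] := set_0Vmem X.
  have cu : #|u |: X| = 1 by rewrite X0 setU0 cards1.
  have := leq_trans (subset_leq_card fullS) (leq_card_setU _ _).
  by move: bdc; rewrite cardsT cu euv; move: Vk; lia.
have nv : [set v] != set0 by apply/set0Pn; exists v; rewrite inE.
have nfull : [set v] :|: nbhd [set v] != [set: V].
  apply/eqP=> /setP/(_ x); rewrite !inE => /orP[/eqP xv|].
    by move: vX; rewrite -xv xX.
  case/exists_inP=> z /set1P->; rewrite e_sym.
  by have /and3P[_ _ /negPf->] := Xuv x xX.
have := cut _ nv nfull; suff le : #|boundary [set v]| <= #|S|.+1.
  by move=> lt; have := leq_trans lt le; rewrite ltnS.
have : boundary [set v] \subset u |: S.
  apply/subsetP=> w; rewrite in_setD => /andP[wv]; rewrite inE => /exists_inP[z /set1P->] vw.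
  have := subsetP fullS w (in_setT _); rewrite in_setU in_setU => /orP[/orP[]|].
  - by rewrite !inE => ->.
  - by move/Xuv; rewrite e_sym vw !andbF.
  - move/(subsetP bdS); rewrite euv in_setU => /orP[wS|]; first by rewrite in_setU1 wS orbT.
    by move=> wv'; rewrite wv' in wv.
move/subset_leq_card/leq_trans; apply; rewrite cardsU1.
by case: (u \in S); rewrite ?add1n ?add0n.
Qed.

(** Every vertex is linked to itself, so only the tokens in [X] need further partners. If an inner
    vertex in [X] is adjacent to [v], all tokens are available; if not, [boundary_bound] provides
    enough new neighbours. *)
Lemma link_hall (X : {set 'I_k.+1 + V}) :
  (forall A : {set V}, A != set0 -> A :|: nbhd A != [set: V] -> k < #|boundary A|) ->
  k.+1 < #|V| -> #|X| <= #|\bigcup_(x in X) link_nbhd x|.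
Proof.
move=> cut Vk; set NX := \bigcup_(x in X) _.
pose J := [set i | inl i \in X]; pose Y := [set w | inr w \in X].
have inlI : injective (@inl 'I_k.+1 V) by move=> ? ? [].
have inrI : injective (@inr 'I_k.+1 V) by move=> ? ? [].
have cardI (J1 : {set 'I_k.+1}) (Y1 : {set V}) :
    #|[set inl j | j in J1] :|: [set inr w | w in Y1]| = #|J1| + #|Y1| :> nat.
  rewrite cardsU (_ : _ :&: _ = set0) ?cards0 ?subn0 ?card_imset //.
  by apply/setP=> x; rewrite !inE; apply/andP=> -[/imsetP[j _ ->] /imsetP[w]].
have cardX : #|X| = #|J| + #|Y|.
  rewrite -cardI; apply: eq_card => -[i|w]; rewrite !inE.
    rewrite mem_imset // inE orbC; case: imsetP => [[]//|_].
    by rewrite orFb.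
  by rewrite mem_imset // inE; case: imsetP => [[]//|_].
have inr_NX w : w \in Y -> inr w \in NX.
  by rewrite inE => wX; apply/bigcupP; exists (inr w); rewrite ?inE /= ?eqxx.
rewrite cardX.
have [J0|[i iJ]] := set_0Vmem J.
  rewrite J0 cards0 add0n -[#|Y|]add0n -(cards0 'I_k.+1) -cardI imset0 set0U.
  by apply/subset_leq_card/subsetP=> x /imsetP[w wY ->]; exact: inr_NX.
case: (boolP [exists w in Y, [&& w != u, w != v & e w v]]).
  case/exists_inP=> w; rewrite inE => wY wv.
  apply: (@leq_trans (#|[set: 'I_k.+1]| + #|Y|)).
    by rewrite leq_add2r subset_leq_card ?subsetT.
  rewrite -cardI; apply/subset_leq_card/subsetP=> x; rewrite in_setU.
  case/orP=> /imsetP[z zI ->]; last exact: inr_NX.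
  by apply/bigcupP; exists (inr w); rewrite ?inE.
rewrite negb_exists_in => /forall_inP noexit.
pose Y1 := Y :\: [set u; v].
have Y1P w : w \in Y1 -> [&& w != u, w != v & ~~ e w v].
  rewrite !inE negb_or => /andP[/andP[wu wv] wX].
  by have := noexit w; rewrite inE wu wv /= => /(_ wX) ->.
have lt := boundary_bound cut Vk Y1P; set S := _ :\: _ in lt.
(* The edge [uv] leads to a single token, because only one of the disjoint paths can use it. *)
pose J1 : {set 'I_k.+1} := if e u v then [set ord0] else set0.
apply: (@leq_trans (#|J1| + #|Y :|: S|)).
  have -> : #|Y :|: S| = #|Y| + #|S|.
    rewrite cardsU (_ : Y :&: S = set0) ?cards0 ?subn0 //.
    apply/setP=> w; rewrite !inE; case: (w == u); case: (w == v); rewrite ?andbF ?orbT //=.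
    by case: (inr w \in X).
  have -> : #|J1| = e u v by rewrite /J1; case: (e u v); rewrite ?cards1 ?cards0.
  rewrite addnC addnCA leq_add2l addnC; apply: leq_trans lt.
  by rewrite (leq_trans (max_card _)) ?card_ord.
rewrite -cardI; apply/subset_leq_card/subsetP=> x; rewrite in_setU => /orP[].
  case/imsetP=> j; rewrite /J1; case: ifP => euv; rewrite ?inE // => /eqP-> ->.
  by apply/bigcupP; exists (inl i); rewrite ?inE //= ?euv ?eqxx //; rewrite inE in iJ.
case/imsetP=> w; rewrite in_setU => /orP[wY|wS] ->; first exact: inr_NX.
move: wS; rewrite in_setD !in_setU !in_set1 !negb_or => /andP[/and3P[_ wu wv]].
rewrite inE => /exists_inP[z zY zw].
move: zY; rewrite in_setU1 => /orP[/eqP zu|zY1].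
  by apply/bigcupP; exists (inl i); rewrite ?inE /= -?zu ?zw //; rewrite inE in iJ.
apply/bigcupP; exists (inr z); rewrite ?inE /=.
  by move: zY1; rewrite !inE => /andP[].
by have /and3P[-> -> _] := Y1P z zY1; rewrite zw wu wv orbT.
Qed.

Definition is_inl (x : 'I_k.+1 + V) : bool := if x is inl _ then true else false.

Definition token_vertex (x : 'I_k.+1 + V) : V := if x is inr w then w else u.

(** * Paths read off from the orbits of the tokens *)

Section Orbits.
Variable f : 'I_k.+1 + V -> 'I_k.+1 + V.
Hypotheses (f_inj : injective f) (f_link : forall x, link_rel x (f x)).

(** [s] is the stretch of the orbit of [x] strictly between [x] and the next token. *)
Definition token_path (x : 'I_k.+1 + V) (s : seq V) : Prop :=
  map inr s = traject f (f x) (size s) /\ is_inl (iter (size s).+1 f x).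

Lemma iter_injective n : injective (iter n f).
Proof. by elim: n => //= n IH x y /f_inj/IH. Qed.

Lemma token_path_cons x w s :
  token_path x (w :: s) <-> f x = inr w /\ token_path (f x) s.
Proof.
rewrite /token_path /= -iterSr; split=> [[[-> ->] H]|[-> [-> H]]]; split=> //; split=> //.
Qed.

(** Distinctness excludes the links from a vertex to itself, so every link followed is an edge; the
    link relation keeps [u] and [v] out of the interior. *)
Lemma token_path_walk s x :
  is_inl x || ((token_vertex x != u) && (token_vertex x != v)) ->
  token_path x s -> uniq (x :: map inr s) ->
  path e (token_vertex x) (rcons s v) && all (fun w => (w != u) && (w != v)) s.
Proof.
elim: s x => [|w s IH] x.
  move=> gx [_ /=]; have := f_link x; case: x gx => [i|z] /=; case: (f _) => //= j.
    by move=> _ /andP[-> _].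
  by move=> _ /and3P[_ _ ->].
move=> gx /token_path_cons[fx bx] /andP[nx us].
have [xw wuv] : e (token_vertex x) w /\ (w != u) && (w != v).
  have := f_link x; rewrite fx; move: gx nx; case: (x) => [i|z] /=.
    by move=> _ _ /andP[uw ->]; rewrite uw andbT; split=> //; apply: contraTneq uw => ->; rewrite e_irr.
  move=> /= zuv; rewrite inE negb_or => /andP[zw _] /orP[/eqP E|/and5P[-> _ _ -> ->//]].
  by rewrite E eqxx in zw.
rewrite /= xw wuv /=; move: bx us; rewrite fx => bx us.
by apply: (IH (inr w)); rewrite //= wuv.
Qed.

(** [f] permutes a finite set, so the orbit of a token returns to a token. Nothing repeats before
    the first return, since by injectivity a repetition would yield an earlier return. *)
Lemma token_path_exists (i : 'I_k.+1) : exists2 s : seq V,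
  token_path (inl i) s & uniq (inl i :: map inr s : seq ('I_k.+1 + V)).
Proof.
have ex : exists n, is_inl (iter n.+1 f (inl i)).
  exists (order f (inl i)).-1; rewrite prednK ?order_gt0 //.
  by rewrite iter_order.
have nP := ex_minnP ex; case: nP => n nI nmin.
pose s := [seq token_vertex (iter j.+1 f (inl i)) | j <- iota 0 n].
have sE : map inr s = traject f (f (inl i)) n.
  rewrite -map_comp; apply: (@eq_from_nth _ (f (inl i))).
    by rewrite size_map size_iota size_traject.
  move=> j; rewrite size_map size_iota => jn.
  rewrite (nth_map 0) ?size_iota // nth_iota // add0n nth_traject //= -iterSr /=.
  case E: (f _) => [l|//]; have := nmin j; rewrite /= E => /(_ isT).
  by rewrite leqNgt jn.
exists s; first by rewrite /token_path size_map size_iota -sE.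
rewrite sE -/(traject f (inl i) n.+1) looping_uniq; apply/negP=> /trajectP[j jn E].
have : iter (n - j) f (inl i) = inl i.
  by apply: (@iter_injective j); rewrite -iterD subnKC ?E //; exact: ltnW.
move: jn; rewrite -subn_gt0; case D: (n - j) => [//|d] _ Ed.
have : n <= d by apply: nmin; rewrite Ed.
by move: D; lia.
Qed.

(** Going back from a common vertex along both orbits, injectivity puts one starting token on the
    other orbit. No token lies between a start and [w], so the two starts coincide. *)
Lemma token_path_disjoint i j s t w :
  token_path (inl i) s -> token_path (inl j) t -> w \in s -> w \in t -> i = j.
Proof.
move=> [sE _] [tE _].
have key l r : map inr r = traject f (f (inl l)) (size r) -> w \in r ->
    exists a, [/\ iter a.+1 f (inl l) = inr w
      & forall b, b <= a -> ~~ is_inl (iter b.+1 f (inl l))].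
  move=> rE wr; have lt : index w r < size r by rewrite index_mem.
  have nthE b : b < size r -> iter b.+1 f (inl l) = inr (nth w r b).
    by move=> br; rewrite iterSr -(nth_traject _ br) -rE (nth_map w).
  exists (index w r); split=> [|b le]; first by rewrite nthE ?nth_index.
  by rewrite nthE // (leq_ltn_trans le).
move=> /(key _ _ sE)[a [Ea Na]] /(key _ _ tE)[b [Eb Nb]].
wlog le_ab : i j a b s t sE tE Ea Na Eb Nb / a <= b.
  move=> W; case/orP: (leq_total a b) => le; first exact: (W i j a b s t).
  by apply: esym; apply: (W j i b a t s).
have : iter (b - a) f (inl j) = inl i.
  by apply: (@iter_injective a.+1); rewrite -iterD addSn subnKC // Ea Eb.
case D: (b - a) => [|d] /= E; first by case: E.
have /negP[] : ~~ is_inl (iter d.+1 f (inl j)) by apply: Nb; move: D; lia.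
by rewrite /= E.
Qed.

End Orbits.

Lemma connectivity_local :
  (forall A : {set V}, A != set0 -> A :|: nbhd A != [set: V] -> k < #|boundary A|) ->
  k.+1 < #|V| -> k < local_connectivity e u v.
Proof.
move=> cut Vk.
have [f fI fN] := hall_marriage (inl ord0) (fun X => link_hall X cut Vk).
have fL x : link_rel x (f x) by have := fN x; rewrite inE.
have bE i : exists s, [&& uniq (inl i :: map inr s : seq ('I_k.+1 + V)),
    map inr s == traject f (f (inl i)) (size s) & is_inl (iter (size s).+1 f (inl i))].
  by have [s [sE sI] us] := token_path_exists fI i; exists s; rewrite us sE eqxx sI.
pose p i := xchoose (bE i).
have pB i : token_path f (inl i) (p i) by have /and3P[_ /eqP] := xchooseP (bE i).
have pU i : uniq (inl i :: map inr (p i) : seq ('I_k.+1 + V)).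
  by have /and3P[] := xchooseP (bE i).
have inrI : injective (@inr 'I_k.+1 V) by move=> ? ? [].
have pU' i : uniq (p i) by have := pU i; rewrite cons_uniq map_inj_uniq // => /andP[].
have pS i : size (p i) <= #|V| by rewrite -(card_uniqP (pU' i)) max_card.
pose q i : #|V|.-bseq V := Bseq (pS i).
have qE i : q i = p i :> seq V by [].
have pD i j w : w \in p i -> w \in p j -> i = j.
  exact: token_path_disjoint (pB i) (pB j).
(* Equal nonempty paths share a vertex; empty ones both follow the edge [uv], which leads only to
   the token [ord0]. *)
have qI : injective q.
  move=> i j /(congr1 val) /= E; case Ei: (p i) => [|w s]; last first.
    by apply: (pD i j w); rewrite -?E Ei mem_head.
  have nilE l : p l = [::] -> f (inl l) = inl ord0.
    move=> El; have [_] := pB l; rewrite El /=; have := fL (inl l).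
    by case: (f _) => //= m /andP[_ /eqP->].
  have : f (inl i) = f (inl j) by rewrite !nilE // -E.
  by move/fI => [].
apply: (@leq_trans #|[set q i | i in 'I_k.+1]|); first by rewrite card_imset ?card_ord.
rewrite /local_connectivity; apply: (@leq_bigmax_cond _ _ (fun P : {set #|V|.-bseq V} => #|P|)).
apply/andP; split.
  apply/forall_inP=> _ /imsetP[i _ ->]; rewrite /is_uvpath qE.
  have /andP[pathp allp] := token_path_walk fL (isT : is_inl (inl i) || _) (pB i) (pU i).
  rewrite pathp /= mem_rcons inE negb_or neq_uv rcons_uniq pU' andbT /=.
  apply/andP; split; apply/negP=> H; have := allP allp _ H; rewrite eqxx ?andbF //.
apply/forall_inP=> _ /imsetP[i _ ->]; apply/forall_inP=> _ /imsetP[j _ ->].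
apply/implyP=> nq; rewrite disjoint_has; apply/hasPn=> w wi; apply/negP=> wj.
by move: nq; rewrite (pD i j w) ?eqxx.
Qed.

End Linkage.

(** [boundary A] separates [A] from the complement of its closed neighbourhood, so this is the
    criterion by vertex cuts. The bound on [#|V|] also covers the initial value of the minimum. *)
Lemma k_connectedI k :
  (forall A : {set V}, A != set0 -> A :|: nbhd A != [set: V] -> k <= #|boundary A|) ->
  k < #|V| -> k_connected e k.
Proof.
case: k => [//|k] cut Vk; rewrite /k_connected /connectivity.
elim/big_ind: _ => [|a b ka kb|[u v] /= uv]; first by rewrite ltn_predRL.
  by rewrite leq_min ka kb.
exact: connectivity_local.
Qed.

End Menger.

(** * Connectivity of a cluster *)

Section Cluster.
Variable m : nat.

(** [None] is the hub, [Some (j, c)] corner [c] of hexagon [j] counted from the innermost one.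
    Corners are added modulo 6. *)
Definition cluster_vertex : finType := option ('I_m.+2 * 'I_6).

Definition ring_step (c d : 'I_6) : bool := (d == c + 1)%R || (c == d + 1)%R.

Definition cluster_adj (x y : cluster_vertex) : bool :=
  match x, y with
  | None, None => false
  | None, Some (j, _) | Some (j, _), None => j == 0 :> nat
  | Some (i, c), Some (j, d) =>
      (i == j) && ring_step c d
      || ((j == i.+1 :> nat) || (i == j.+1 :> nat)) && ((c == d) || ring_step c d)
  end.

Lemma ring_step_sym : symmetric ring_step.
Proof. by move=> c d; rewrite /ring_step orbC. Qed.

Lemma cluster_adj_sym : symmetric cluster_adj.
Proof.
move=> [[i c]|] [[j d]|] //=; rewrite ring_step_sym [c == d]eq_sym [i == j]eq_sym.
by rewrite [X in _ || X && _]orbC.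
Qed.

Lemma ring_step_irr c : ring_step c c = false.
Proof. by rewrite /ring_step -{1 3}[c]addr0 (inj_eq (addrI c)). Qed.

Lemma cluster_adj_irr : irreflexive cluster_adj.
Proof.
move=> [[i c]|] //=; rewrite ring_step_irr andbF /=.
by rewrite (_ : i == i.+1 :> nat = false) //; apply/eqP; lia.
Qed.

Lemma I6_cases (d : 'I_6) : d \in [:: 0; 1; 2%:R; 3%:R; -1; - 2%:R]%R.
Proof. by case: d => [[|[|[|[|[|[|//]]]]]] ?]; rewrite !inE -!val_eqE. Qed.

Lemma I6_missing (T : {set 'I_6}) : #|T| < 6 -> exists d, d \notin T.
Proof.
move=> lt; apply/existsP; rewrite -negb_forall; apply: contraL lt => /forallP all.
by rewrite -leqNgt -[X in X <= _](card_ord 6) subset_leq_card //; apply/subsetP=> d _.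
Qed.

Variable S : {set cluster_vertex}.

(** For [Z] disjoint from [S] this says that [Z] is a union of components of the cluster without
    [S]. *)
Definition closed_off (Z : {set cluster_vertex}) : Prop :=
  forall x y, x \in Z -> cluster_adj x y -> y \notin S -> y \in Z.

(** Pigeonhole: [f] colours the vertices so that the colour classes contain disjoint paths, and [S]
    misses some class whose colour is not in [T]. *)
Lemma I6_free (f : cluster_vertex -> 'I_6) (T : {set 'I_6}) :
  #|S| + #|T| < 6 -> exists2 d, d \notin T & forall x, f x = d -> x \notin S.
Proof.
move=> lt; have [|d] := @I6_missing ((f @: S) :|: T).
  apply: leq_ltn_trans lt; apply: leq_trans (leq_card_setU _ _) _.
  by rewrite leq_add2r leq_imset_card.
rewrite in_setU negb_or => /andP[dS dT]; exists d => // x xd.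
by apply: contra dS => xS; rewrite -xd imset_f.
Qed.

(* Five vertices cannot block the six disjoint paths leading from a vertex of
   one ring to the six vertices of the next ring outwards. *)
Lemma closed_up Z (j j' : 'I_m.+2) c : #|S| < 6 -> closed_off Z ->
  Some (j, c) \in Z -> j' = j.+1 :> nat -> exists d, Some (j', d) \in Z.
Proof.
move=> S5 clZ jZ jj'.
pose f (x : cluster_vertex) : 'I_6 := match x with
  | None => (c + 3%:R)%R
  | Some (i, a) => if i == j' then a else
      if (i == j) && (a == c + 1)%R then (c + 2%:R)%R else
      if (i == j) && (a == c - 1)%R then (c - 2%:R)%R else (c + 3%:R)%R end.
have [|d _ dS] := @I6_free f set0; first by rewrite cards0 addn0.
exists d; have ed : d = (c + (d - c))%R by rewrite addrC subrK.
have d'S : Some (j', d) \notin S by apply: dS; rewrite /= eqxx.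
have njj' : (j == j') = false by apply/eqP=> E; move: jj'; rewrite E; lia.
have stepU a b : Some (j, a) \in Z -> b \in [:: a; a + 1; a - 1]%R -> 
    Some (j', b) \notin S -> Some (j', b) \in Z.
  move=> aZ ab bS; apply: clZ aZ _ bS; rewrite /= jj' eqxx orTb andTb /ring_step.
  move: ab; rewrite !inE => /or3P[]/eqP->; rewrite ?eqxx ?orbT //.
  by rewrite subrK eqxx !orbT.
have eqc a b : (c + a == c + b)%R = (a == b) by rewrite (inj_eq (addrI c)).
move: (I6_cases (d - c)%R); rewrite !inE; case/or4P=> [|||/or3P[]] /eqP dc;
  rewrite dc in ed.
- by apply: stepU jZ _ d'S; rewrite ed addr0 !inE eqxx.
- by apply: stepU jZ _ d'S; rewrite ed !inE eqxx orbT.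
- have cZ : Some (j, c + 1)%R \in Z.
    apply: clZ jZ _ _; first by rewrite /= eqxx /ring_step eqxx.
    by apply: dS; rewrite /= njj' !eqxx /=.
  apply: stepU cZ _ d'S; rewrite ed !inE -addrA eqc; apply/or3P; apply: Or32.
  by rewrite eqc.
(* The path to the opposite corner runs through the hub if [j] is the innermost ring, and otherwise
   through corner [c + 1] of the ring inside. *)
- have cZ : exists2 b, Some (j, b) \in Z & (b \in [:: c + 2%:R; c + 3%:R]%R).
    case: (posnP j) => [j0|jpos].
      exists (c + 3%:R)%R; last by rewrite !inE eqxx orbT.
      have nZ : None \in Z by apply: clZ jZ _ _; [rewrite /= j0|apply: dS].
      apply: clZ nZ _ _; first by rewrite /= j0.
      by apply: dS; rewrite /= njj' eqxx /= !eqc /=.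
    have jlt : j.-1 < m.+2 by rewrite (leq_ltn_trans (leq_pred _)).
    have [i iE] : exists i : 'I_m.+2, i.+1 = j :> nat.
      by exists (Ordinal jlt); rewrite /= prednK.
    have ij : (i == j) = false by apply/negbTE; rewrite -val_eqE /= -iE neq_ltn leqnn.
    have ij' : (i == j') = false.
      by apply/negbTE; rewrite -val_eqE /= jj' -iE neq_ltn ltnS leqnSn.
    have iZ : Some (i, c + 1)%R \in Z.
      apply: clZ jZ _ _; last by apply: dS; rewrite /= ij ij'.
      by rewrite /= iE eqxx !orbT /= /ring_step eqxx /= !orbT.
    exists (c + 2%:R)%R; last by rewrite !inE eqxx.
    apply: clZ iZ _ _; last by apply: dS; rewrite /= njj' eqxx /= !eqc.
    rewrite /= iE eqxx /= /ring_step; apply/orP; right; apply/orP; right.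
    by rewrite -addrA eqc.
  case: cZ => b bZ; rewrite !inE => bc; apply: stepU bZ _ d'S.
  rewrite ed !inE; case/orP: bc => /eqP->; last by rewrite eqxx.
  by rewrite -!addrA !eqc.
- by apply: stepU jZ _ d'S; rewrite ed !inE eqxx !orbT.
- have cZ : Some (j, c - 1)%R \in Z.
    apply: clZ jZ _ _; first by rewrite /= eqxx /ring_step subrK eqxx orbT.
    by apply: dS; rewrite /= njj' !eqxx /= eqc.
  by apply: stepU cZ _ d'S; rewrite ed !inE -!addrA !eqc.
Qed.

Lemma closed_top Z w : #|S| < 6 -> closed_off Z -> w \in Z ->
  exists d, Some (ord_max, d) \in Z.
Proof.
move=> S5 clZ wZ.
have up n j c : Some (j, c) \in Z -> m.+1 - j <= n -> exists d, Some (ord_max, d) \in Z.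
  elim: n j c => [|n IH] j c jZ le.
    exists c; rewrite (_ : ord_max = j) //; apply: val_inj => /=.
    by have := ltn_ord j; move: le; lia.
  case: (ltnP j m.+1) => jm; last by apply: (IH j c) => //; move: jm; lia.
  have [d dZ] := closed_up (j' := @Ordinal m.+2 j.+1 jm) S5 clZ jZ erefl.
  by apply: (IH _ d dZ) => /=; move: le; lia.
case: w wZ => [[j c] jZ|nZ]; first exact: up jZ (leqnn _).
pose f (x : cluster_vertex) : 'I_6 := if x is Some (_, a) then a else ord0.
have [|d _ dS] := @I6_free f set0; first by rewrite cards0 addn0.
apply: (up _ ord0 d _ (leqnn _)); apply: clZ nZ _ _ => //.
exact: dS.
Qed.

(** Four vertices cannot block the five disjoint paths from a corner of one ring to the corners of
    the next ring inwards other than the opposite one. Descending ring by ring reaches the hub. *)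
Lemma closed_center Z w : #|S| < 5 -> closed_off Z -> None \notin S ->
  w \in Z -> None \in Z.
Proof.
move=> S4 clZ nS; case: w => [[j c]|//].
elim: {j}(val j) {-2}j (erefl (val j)) c => [|n IH] j jE c jZ.
  by apply: clZ jZ _ nS; rewrite /= -[X in X == _]/(val j) jE.
have nlt : n < m.+2 by have := ltn_ord j; rewrite -[X in X < _]/(val j) jE; apply: ltnW.
have [i iE] : exists i : 'I_m.+2, val i = n by exists (Ordinal nlt).
suff [d dZ] : exists d, Some (i, d) \in Z by apply: (IH i iE d).
have ij : j = i.+1 :> nat by rewrite -[LHS]/(val j) jE -iE.
have nij : (j == i) = false by rewrite -val_eqE /= ij; apply/eqP; lia.
have eqc a b : (c + a == c + b)%R = (a == b) by rewrite (inj_eq (addrI c)).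
pose f (x : cluster_vertex) : 'I_6 := match x with
  | None => (c + 3%:R)%R
  | Some (l, a) => if l == i then a else
      if a == (c + 1)%R then (c + 2%:R)%R else (c - 2%:R)%R end.
have [|d dT dS] := @I6_free f [set c + 3%:R]%R; first by rewrite cards1 addn1.
exists d; have ed : d = (c + (d - c))%R by rewrite addrC subrK.
have dS' : Some (i, d) \notin S by apply: dS; rewrite /= eqxx.
have stepD a b : Some (j, a) \in Z -> b \in [:: a; a + 1; a - 1]%R ->
    Some (i, b) \notin S -> Some (i, b) \in Z.
  move=> aZ ab bS; apply: clZ aZ _ bS; rewrite /= ij eqxx orbT andTb /ring_step.
  move: ab; rewrite !inE => /or3P[]/eqP->; rewrite ?eqxx ?orbT //.
  by rewrite subrK eqxx !orbT.
move: (I6_cases (d - c)%R); rewrite !inE; case/or4P=> [|||/or3P[]] /eqP dc;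
  rewrite dc in ed.
- by apply: stepD jZ _ dS'; rewrite ed addr0 !inE eqxx.
- by apply: stepD jZ _ dS'; rewrite ed !inE eqxx orbT.
- have cZ : Some (j, c + 1)%R \in Z.
    apply: clZ jZ _ _; first by rewrite /= eqxx /ring_step eqxx.
    by apply: dS; rewrite /= nij !eqxx.
  by apply: stepD cZ _ dS'; rewrite ed !inE -!addrA !eqc.
- by move: dT; rewrite ed in_set1 eqxx.
- by apply: stepD jZ _ dS'; rewrite ed !inE eqxx !orbT.
- have cZ : Some (j, c - 1)%R \in Z.
    apply: clZ jZ _ _; first by rewrite /= eqxx /ring_step subrK eqxx orbT.
    by apply: dS; rewrite /= nij eqc.
  by apply: stepD cZ _ dS'; rewrite ed !inE -!addrA !eqc.
Qed.

Lemma closed_ring Z j (s : 'I_6) c t : closed_off Z -> (s == 1)%R || (s == -1)%R ->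
  Some (j, c) \in Z -> (forall n, n < t -> Some (j, c + s *+ n.+1)%R \notin S) ->
  Some (j, c + s *+ t)%R \in Z.
Proof.
move=> clZ s1 jZ; elim: t => [|t IH] out; first by rewrite mulr0n addr0.
apply: clZ (IH _) _ (out t (leqnn _)) => [n nt|]; first by apply: out; apply: leqW.
rewrite /= eqxx /ring_step mulrSr addrA; case/orP: s1 => /eqP->; first by rewrite eqxx.
by rewrite subrK eqxx orbT.
Qed.

(* Column [d] is reached along four disjoint paths, in both directions of two
   consecutive rings. *)
Lemma closed_column Z w d : #|S :\ None| < 4 -> closed_off Z -> w \in Z -> w != None ->
  (forall i, Some (i, d) \notin S) -> exists i, Some (i, d) \in Z.
Proof.
move=> S3 clZ; case: w => [[j c] jZ _|//] colS.
have [j' jj'] : exists j' : 'I_m.+2, (j' == j.+1 :> nat) || (j == j'.+1 :> nat).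
  case: (ltnP j m.+1) => jm; first by exists (@Ordinal m.+2 j.+1 jm); rewrite eqxx.
  by exists (@Ordinal m.+2 m (leqW (leqnn _))); rewrite orbC eqn_leq jm -ltnS ltn_ord.
have njj' : (j' == j) = false by apply/eqP=> E; move: jj'; rewrite E; lia.
have [->|ncd] := eqVneq d c; first by exists j.
pose k := val (d - c)%R; have k6 : k < 6 := ltn_ord _.
have kpos : 0 < k by rewrite lt0n; apply: contra ncd => k0; rewrite -subr_eq0.
have dE : d = (c + 1 *+ k)%R by rewrite natr_Zp addrC subrK.
have dE' : d = (c + (-1) *+ (6 - k))%R.
  rewrite dE mulNrn natrB ?(ltnW k6) // opprB.
  by rewrite (_ : 6%:R = 0 :> 'I_6)%R ?subr0 //; apply/eqP.
(* Colours 0 and 1 are the two arcs from column [c] to column [d] in ring [j], colours 2 and 3 those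
   in the other rings: offsets from [c] below [k] belong to the increasing arc. Colours 4 and 5 are
   excluded below. *)
pose f (x : cluster_vertex) : 'I_6 := match x with
  | None => 5%:R%R
  | Some (i, a) => inord ((if i == j then 0 else 2) + (k <= val (a - c)%R)) end.
have [col colT colS'] : exists2 col : 'I_6, col < 4 &
    forall x, f x = col -> x != None -> x \notin S.
  have [|col] := @I6_missing ((f @: (S :\ None)) :|: [set 4%:R; 5%:R]%R).
    apply: leq_ltn_trans (leq_card_setU _ _) _; rewrite cards2.
    apply: (@leq_ltn_trans (3 + 2)) => //; apply: leq_add; last by case: eqP.
    exact: leq_trans (leq_imset_card _ _) _.
  rewrite !inE !negb_or => /and3P[cS c4 c5]; exists col.
    by move: col c4 c5 {cS} => [[|[|[|[|[|[|//]]]]]] ?].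
  move=> x fx nx; apply: contra cS => xS; rewrite -fx imset_f // !inE nx xS //.
have fv i t : f (Some (i, c + t)%R) = inord ((if i == j then 0 else 2) + (k <= val t)).
  by rewrite /f addrAC subrr add0r.
have val1 n : n < 6 -> val (1 *+ n : 'I_6)%R = n.
  by move=> n6; rewrite Zp_nat /= modn_small.
have valN n : 0 < n -> n < 6 -> val ((-1) *+ n : 'I_6)%R = 6 - n.
  move=> n0 n6; rewrite mulNrn Zp_nat /= (modn_small n6) modn_small //; lia.
have fE i a : f (Some (i, a)) = col ->
  Some (i, a) \notin S by move=> fa; apply: colS'.
have go i (s : 'I_6) a t : (s == 1)%R || (s == -1)%R -> Some (i, c + s *+ a)%R \in Z -> a <= t ->
    (forall n, a < n -> n < t -> f (Some (i, c + s *+ n)%R) = col) ->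
    d = (c + s *+ t)%R -> exists i', Some (i', d) \in Z.
  move=> s1 aZ lat fcol dt; exists i.
  have := @closed_ring Z i s (c + s *+ a)%R (t - a) clZ s1 aZ.
  rewrite -addrA -mulrnDr subnKC // -dt; apply=> n lt.
  rewrite -addrA -mulrnDr; have [E|ne] := eqVneq (a + n.+1) t.
    by rewrite E -dt colS.
  by apply: fE; apply: fcol; move: lt ne; lia.
have stepR s : (s == 1)%R || (s == -1)%R -> f (Some (j', c + s *+ 1)%R) = col ->
    Some (j', c + s *+ 1)%R \in Z.
  move=> s1 fs; apply: clZ jZ _ (fE _ _ fs).
  rewrite /= jj' mulr1n /ring_step; case/orP: s1 => /eqP->; rewrite ?eqxx ?orbT //.
  by rewrite subrK eqxx !orbT.
have inordE n : n < 6 -> n = col :> nat -> inord n = col by move=> _ ->; rewrite inord_val.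
case: (ltnP (col) 2) => col2; case: (eqVneq (col %% 2) 0) => par.
- have col0 : col = 0 :> nat by move: par; rewrite modn_small.
  apply: (@go j 1%R 0 k) => //; rewrite ?mulr0n ?addr0 // => n n0 nk.
  rewrite fv eqxx val1 ?(ltn_trans nk) // leqNgt nk.
  exact: inordE.
- have col1 : col = 1 :> nat by move: par; rewrite modn_small //; lia.
  apply: (@go j (-1)%R 0 (6 - k)) => //; rewrite ?mulr0n ?addr0 // => n n0 nk.
  rewrite fv eqxx valN //; last by move: nk; lia.
  rewrite (_ : k <= 6 - n); first exact: inordE.
  by move: nk; lia.
- have col0 : col = 2 :> nat by move: par col2 colT; lia.
  have E n : n < k -> f (Some (j', c + 1 *+ n)%R) = col.
    move=> nk; rewrite fv njj' val1 ?(ltn_trans nk) // leqNgt nk.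
    exact: inordE.
  (* If [d] follows [c], a diagonal from ring [j] reaches column [d] at once. *)
  case: (ltnP 1 k) => k1; last first.
    exists j'; apply: clZ jZ _ (colS j'); rewrite dE (_ : k = 1); last by move: k1 kpos; lia.
    by rewrite /= jj' mulr1n /ring_step eqxx !orbT.
  apply: (@go j' 1%R 1 k) => //; first by apply: stepR (E _ k1).
  by move=> n n0 nk; apply: E.
- have col0 : col = 3 :> nat by move: par col2 colT; lia.
  have E n : 0 < n -> n < 6 - k -> f (Some (j', c + (-1) *+ n)%R) = col.
    move=> n0 nk; rewrite fv njj' valN //; last by move: nk; lia.
    rewrite (_ : k <= 6 - n); last by move: nk; lia.
    exact: inordE.
  case: (ltnP 1 (6 - k)) => k1; last first.
    exists j'; apply: clZ jZ _ (colS j'); rewrite dE' (_ : 6 - k = 1); last by move: k1 k6; lia.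
    by rewrite /= jj' mulr1n /ring_step subrK eqxx !orbT.
  apply: (@go j' (-1)%R 1 (6 - k)) => //; first by apply: stepR (E _ _ k1).
    by move: k1; lia.
  by move=> n n0 nk; apply: E nk; apply: ltnW.
Qed.

(** If the hub survives, both [Z] and the remaining part would contain it. If not, at most three
    other vertices are deleted, both parts meet a column that avoids [S], and this column is a
    path. *)
Lemma closed_connected Z w x : #|S| < 5 -> closed_off Z -> w \in Z -> w \notin S ->
  x \notin S -> x \in Z.
Proof.
move=> S4 clZ wZ wS xS; pose Z' := ~: (Z :|: S).
have clZ' : closed_off Z'.
  move=> a b; rewrite !inE !negb_or => /andP[aZ aS] ab bS; rewrite bS andbT.
  by apply: contra aZ => bZ; apply: clZ bZ _ aS; rewrite cluster_adj_sym.
apply: contraT => xZ; have xZ' : x \in Z' by rewrite !inE negb_or xZ.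
have [nS|nS] := boolP (None \in S); last first.
  have := closed_center S4 clZ' nS xZ'; rewrite !inE negb_or.
  by rewrite (closed_center S4 clZ nS wZ).
have S3 : #|S :\ None| < 4 by move: S4; rewrite (cardsD1 None S) nS.
pose f (y : cluster_vertex) : 'I_6 := if y is Some (_, a) then a else ord0.
have [|d dS] := @I6_missing (f @: (S :\ None)).
  by apply: leq_ltn_trans (leq_imset_card _ _) _; apply: ltn_trans S3 _.
have colS i : Some (i, d) \notin S.
  by apply: contra dS => iS; apply/imsetP; exists (Some (i, d)); rewrite ?inE.
have nn y : y \notin S -> y != None by apply: contraNneq => ->.
have [i iZ] := closed_column S3 clZ wZ (nn _ wS) colS.
have [i' iZ'] := closed_column S3 clZ' xZ' (nn _ xS) colS.
have colZ n (l l' : 'I_m.+2) : l' + n = l -> 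
   (Some (l, d) \in Z) = (Some (l', d) \in Z).
  elim: n l => [|n IH] l; first by rewrite addn0 => /val_inj->.
  move=> E; have lt : l' + n < m.+2 by have := ltn_ord l; rewrite -E; lia.
  rewrite -(IH (Ordinal lt)) //; apply/idP/idP => lZ; apply: clZ lZ _ (colS _).
    by rewrite /= -E addnS !eqxx !orbT.
  by rewrite /= -E addnS !eqxx !orbT.
move: iZ'; rewrite !inE negb_or; case/orP: (leq_total i i') => le.
  by rewrite (colZ (i' - i) i' i) ?subnKC // iZ.
by rewrite -(colZ (i - i') i i') ?subnKC // iZ.
Qed.

End Cluster.

(** * The graphs and their connectivity *)

Definition port : Type := nat * nat.

(* [(k, c)] is corner [c] of the outermost ring of cluster [k]. Six edges leave the
   clusters 0, ..., 6 and nine the clusters 7 and 8. The first ten crossings are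
   between edges joining the same two clusters; the last five are the pairs of
   literals (a, ~a), (c, ~c), (d, ~d), (~b, b), (e, ~e) of the 2-clauses above. *)
Definition crossings : seq ((port * port) * (port * port)) :=
  [:: (((0, 4), (4, 1)), ((0, 5), (4, 2)));
      (((1, 4), (5, 1)), ((1, 5), (5, 2)));
      (((2, 1), (3, 1)), ((2, 2), (3, 2)));
      (((3, 3), (6, 4)), ((3, 4), (6, 5)));
      (((0, 1), (7, 4)), ((0, 2), (7, 5)));
      (((1, 1), (7, 2)), ((1, 2), (7, 3)));
      (((2, 4), (7, 0)), ((2, 5), (7, 1)));
      (((4, 4), (8, 2)), ((4, 5), (8, 3)));
      (((5, 4), (8, 4)), ((5, 5), (8, 5)));
      (((6, 1), (8, 0)), ((6, 2), (8, 1)));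
      (((0, 0), (6, 0)), ((2, 0), (4, 0)));
      (((1, 3), (2, 3)), ((3, 0), (7, 1)));
      (((0, 3), (7, 3)), ((1, 0), (7, 4)));
      (((3, 5), (8, 0)), ((5, 3), (6, 3)));
      (((4, 3), (8, 4)), ((5, 0), (8, 3)))].

Definition exits : seq (port * port) := flatten [seq [:: x.1; x.2] | x <- crossings].

Definition linked (p q : port) : bool := ((p, q) \in exits) || ((q, p) \in exits).

(** * Finite checks over all bipartitions of the nine clusters *)

Fixpoint bitseqs (n : nat) : seq bitseq :=
  if n is n'.+1 then [seq b :: s | b <- [:: true; false], s <- bitseqs n'] else [:: [::]].

Lemma bitseqsP n (s : bitseq) : size s = n -> s \in bitseqs n.
Proof.
elim: n s => [|n IH] [|b s] //= [/IH sn].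
by case: b; rewrite !mem_cat map_f ?orbT.
Qed.

Definition ports (l : seq (port * port)) : seq port := flatten [seq [:: e.1; e.2] | e <- l].

Definition separated (s : bitseq) (e : port * port) : bool := nth false s e.1.1 != nth false s e.2.1.

(** The greedy matching need not be a largest one; it suffices that it reaches six edges across
    every proper bipartition. *)
Fixpoint greedy_matching (l : seq (port * port)) : seq (port * port) :=
  if l is e :: l' then
    let r := greedy_matching l' in
    if (e.1 \in ports r) || (e.2 \in ports r) then r else e :: r
  else [::].

Lemma exits_valid : all (fun e => [&& e.1.1 < 9, e.1.2 < 6, e.2.1 < 9, e.2.2 < 6 & e.1.1 != e.2.1]) exits.
Proof. by []. Qed.

Lemma exits_cut : all (fun s => (constant s) ||
  (6 <= size (greedy_matching (filter (separated s) exits)))) (bitseqs 9).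
Proof. by vm_compute. Qed.

(** The graph of clusters stays connected when one cluster [k] is deleted: entry [k] of the
    bipartition is ignored. This handles cuts contained in a single cluster. *)
Lemma exits_connected : all (fun k => all (fun s =>
     constant (take k s ++ drop k.+1 s) ||
     has (fun e => [&& separated s e, e.1.1 != k & e.2.1 != k]) exits) (bitseqs 9)) (iota 0 9).
Proof. by vm_compute. Qed.

Lemma greedy_matching_sub l : {subset greedy_matching l <= l}.
Proof.
elim: l => //= e l IH x; case: ifP => _; first by move/IH; rewrite inE orbC => ->.
by rewrite !inE => /orP[->//|/IH->]; rewrite orbT.
Qed.

Lemma greedy_matching_uniq l : all (fun e => e.1 != e.2) l -> uniq (ports (greedy_matching l)).
Proof.
elim: l => //= e l IH /andP[ne /IH ul]; case: ifPn => //.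
by rewrite negb_or /ports /= inE negb_or ne ul => /andP[-> ->].
Qed.

Section Graph.
Variable m : nat.

Definition vertex : finType := ('I_9 * cluster_vertex m)%type.

Definition vertex_adj (x y : vertex) : bool :=
  if x.1 == y.1 then cluster_adj x.2 y.2 else
  if (x.2, y.2) is (Some (i, c), Some (j, d)) then
    [&& i == ord_max, j == ord_max & linked (x.1 : nat, c : nat) (y.1 : nat, d : nat)]
  else false.

Lemma linked_sym p q : linked p q = linked q p.
Proof. exact: orbC. Qed.

Lemma vertex_adj_sym : symmetric vertex_adj.
Proof.
move=> [k x] [l y]; rewrite /vertex_adj /= eq_sym; case: ifP => _; first exact: cluster_adj_sym.
case: x => [[i c]|]; case: y => [[j d]|] //; rewrite linked_sym.
by rewrite andbCA.
Qed.

Lemma vertex_adj_irr : irreflexive vertex_adj.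
Proof. by move=> [k x]; rewrite /vertex_adj eqxx cluster_adj_irr. Qed.

Definition cluster_graph : sgraph := SGraph vertex_adj_sym vertex_adj_irr.

Definition port_vertex (p : port) : vertex := (inord p.1, Some (ord_max, inord p.2)).

Definition valid_port (p : port) : bool := (p.1 < 9) && (p.2 < 6).

Lemma port_vertex_inj : {in valid_port &, injective port_vertex}.
Proof.
move=> [k c] [l d] /andP[/= k9 c6] /andP[/= l9 d6] [kl cd].
by move: (congr1 val kl) (congr1 val cd); rewrite /= !inordK // => -> ->.
Qed.

Lemma exit_adj e : e \in exits ->
  [/\ valid_port e.1, valid_port e.2, (port_vertex e.1).1 != (port_vertex e.2).1
    & vertex_adj (port_vertex e.1) (port_vertex e.2)].
Proof.
move=> ee; have /and5P[k9 c6 l9 d6 kl] := allP exits_valid e ee.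
have kl' : (port_vertex e.1).1 != (port_vertex e.2).1 by rewrite -val_eqE /= !inordK.
split; rewrite /valid_port ?k9 ?c6 ?l9 ?d6 //.
rewrite /vertex_adj (negPf kl') /= !eqxx /= /linked !inordK //.
by rewrite -!surjective_pairing ee.
Qed.

Lemma vertex_adj_exit x y : vertex_adj x y -> x.1 != y.1 ->
  exists2 e, e \in exits & (x, y) = (port_vertex e.1, port_vertex e.2) \/
                           (x, y) = (port_vertex e.2, port_vertex e.1).
Proof.
case: x y => [k x] [l y]; rewrite /vertex_adj /=; case: ifP => //= _.
case: x => [[i c]|]; case: y => [[j d]|] // /and3P[/eqP-> /eqP-> /orP[e|e] _].
  by exists (k : nat, c : nat, (l : nat, d : nat)) => //; left; rewrite /port_vertex /= !inord_val.
by exists (l : nat, d : nat, (k : nat, c : nat)) => //; right; rewrite /port_vertex /= !inord_val.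
Qed.

Lemma card_vertex : #|vertex| = 9 * (m.+2 * 6).+1.
Proof. by rewrite card_prod card_option card_prod !card_ord. Qed.

(** * Vertex cuts with fewer than six vertices *)

Section Cut.
Variables (S : {set vertex}).

(** A union of components of the graph without [S]. *)
Definition cut_side (Z : {set vertex}) : Prop :=
  (forall x y, x \in Z -> vertex_adj x y -> y \notin S -> y \in Z) /\ [disjoint Z & S].

Definition slice (Z : {set vertex}) (k : 'I_9) : {set cluster_vertex m} := [set x | (k, x) \in Z].

Lemma slice_cut_side Z k : cut_side Z -> closed_off (slice S k) (slice Z k).
Proof.
move=> [clZ _] x y; rewrite !inE => xZ xy yS; apply: clZ xZ _ yS.
by rewrite /vertex_adj eqxx.
Qed.

Lemma card_slice k : #|slice S k| = #|[set x in S | x.1 == k]|.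
Proof.
have -> : [set x in S | x.1 == k] = [set (k, x) | x in slice S k].
  apply/setP=> -[l x]; rewrite !inE /=; apply/andP/imsetP.
    by case=> xS /eqP E; exists x; rewrite ?inE -?E.
  by case=> z; rewrite inE => zS [-> ->].
by rewrite card_imset // => a b [].
Qed.

Lemma cut_side_disjoint Z x : cut_side Z -> x \in Z -> x \in S -> False.
Proof. by case=> _ dZ xZ xS; have := disjointFr dZ xZ; rewrite xS. Qed.

(* If a cluster meets both sides of a cut [S] of size at most 5, then [S] has
   5 vertices in it, so the other clusters are on one side; the other side then
   leaves the cluster through a corner outside [S]. *)
Lemma cluster_unsplit Z1 Z2 k x y : cut_side Z1 -> cut_side Z2 -> [disjoint Z1 & Z2] ->
  #|S| < 6 -> (k, x) \in Z1 -> (k, y) \in Z2 -> False.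
Proof.
move=> cl1 cl2 d12 S5 xZ1 yZ2.
have notboth z : z \in Z1 -> z \in Z2 -> False by move=> z1 z2; have := disjointFr d12 z1; rewrite z2.
have Sk : 5 <= #|slice S k|.
  rewrite leqNgt; apply/negP=> S4.
  have := closed_connected (w := x) (x := y) S4 (slice_cut_side (k := k) cl1).
  rewrite !inE => /(_ xZ1) H; apply: (notboth (k, y)) => //; apply: H.
    by apply/negP=> /(cut_side_disjoint cl1 xZ1).
  by apply/negP=> /(cut_side_disjoint cl2 yZ2).
have Sin z : z \in S -> z.1 = k.
  have : #|[set z in S | z.1 == k]| = #|S|.
    apply/eqP; rewrite eqn_leq subset_leq_card /=; last by apply/subsetP=> ?; rewrite inE => /andP[].
    by rewrite -card_slice; apply: leq_trans Sk; rewrite -ltnS.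
  move=> E zS; have /eqP eqS : [set z in S | z.1 == k] == S.
    by rewrite eqEcard E leqnn andbT; apply/subsetP=> ?; rewrite inE => /andP[].
  by move: zS; rewrite -eqS inE => /andP[_ /eqP].
have slice0 l : l != k -> #|slice S l| < 5.
  move=> lk; rewrite card_slice (_ : [set _ in _ | _] = set0) ?cards0 //.
  by apply/setP=> z; rewrite !inE; apply/negP=> /andP[/Sin-> /eqP kl]; rewrite kl eqxx in lk.
pose side (l : 'I_9) := (l, None) \in Z1.
have sideE l z : l != k -> ((l, z) \in Z1) = side l.
  move=> lk; have outS u : (l, u) \notin S by apply/negP=> /Sin/= kl; rewrite kl eqxx in lk.
  apply/idP/idP => [lz|lz].
    have := closed_connected (w := z) (x := None) (slice0 l lk) (slice_cut_side (k := l) cl1).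
    by rewrite !inE; apply.
  have := closed_connected (w := None) (x := z) (slice0 l lk) (slice_cut_side (k := l) cl1).
  by rewrite !inE; apply.
pose s := mkseq (fun i => side (inord i)) 9.
have snth p : valid_port p -> nth false s p.1 = side (port_vertex p).1.
  by move=> /andP[p9 _]; rewrite nth_mkseq.
(* The other clusters remain linked to each other, and none of the exits between them is blocked by
   [S]. *)
have const : exists b, forall l, l != k -> side l = b.
  have /allP/(_ k) := exits_connected; rewrite mem_iota ltn_ord => /(_ isT).
  move/allP/(_ s); rewrite bitseqsP ?size_mkseq // => /(_ isT) /orP[cs|/hasP[e eE]].
    have /(constantP false)[b sb] := cs; exists b => l lk.
    have : side l \in take k s ++ drop k.+1 s.
      have sl : side l = nth false s l by rewrite nth_mkseq // inord_val.
      rewrite mem_cat sl; case: (ltngtP l k) => [lt|lt|/val_inj E]; last by rewrite E eqxx in lk.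
        by rewrite -(nth_take _ lt) mem_nth ?orTb // size_takel ?size_mkseq // ltnW.
      apply/orP; right; have -> : nth false s l = nth false (drop k.+1 s) (l - k.+1).
        by rewrite nth_drop subnKC.
      by rewrite mem_nth // size_drop size_mkseq ltn_sub2r // (leq_ltn_trans lt).
    by rewrite sb => /nseqP[].
  have [v1 v2 kl adj] := exit_adj eE.
  rewrite /separated !snth // => /and3P[sep e1k e2k].
  have nk p : valid_port p -> p.1 != k -> (port_vertex p).1 != k.
    by move=> /andP[p9 _] pk; rewrite -val_eqE /= inordK.
  have {}e1k := nk _ v1 e1k; have {}e2k := nk _ v2 e2k.
  have outS z : z.1 != k -> z \notin S by move=> zk; apply/negP=> /Sin E; rewrite E eqxx in zk.
  have Zs z : z.1 != k -> (z \in Z1) = side z.1 by case: z => l z /= /sideE.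
  case: cl1 => cl1 _; move/eqP: sep => []; rewrite -!Zs //.
  apply/idP/idP => H; apply: cl1 H _ (outS _ _) => //.
  by rewrite vertex_adj_sym.
case: const => b bP.
have leave Z z : cut_side Z -> (k, z) \in Z -> exists2 w, w \in Z & w.1 != k.
  move=> clZ zZ.
  have Slt : #|slice S k| < 6.
    rewrite card_slice; apply: leq_ltn_trans S5; apply/subset_leq_card/subsetP=> ?.
    by rewrite inE => /andP[].
  have [|d] := closed_top Slt (slice_cut_side (k := k) clZ) (w := z); first by rewrite inE.
  rewrite inE => dZ.
  have : (k : nat, d : nat) \in ports exits.
    (* Each of the 54 corners is an end of some exit. *)
    have /allP/(_ (k : nat, d : nat)) : all [in ports exits] [seq (a, b) | a <- iota 0 9, b <- iota 0 6] by vm_compute.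
    by apply; apply/allpairsP; exists (k : nat, d : nat); rewrite !mem_iota !ltn_ord.
  case/flattenP=> _ /mapP[e eE ->]; rewrite !inE.
  have [v1 v2 kl adj] := exit_adj eE.
  have pvE : port_vertex (k : nat, d : nat) = (k, Some (ord_max, d)) by rewrite /port_vertex /= !inord_val.
  have outS w : w.1 != k -> w \notin S by move=> wk; apply/negP=> /Sin E; rewrite E eqxx in wk.
  case: clZ => clZ _; case/orP=> /eqP E; rewrite -E pvE in adj kl.
    have nk : (port_vertex e.2).1 != k by rewrite eq_sym.
    by exists (port_vertex e.2) => //; apply: clZ dZ adj (outS _ nk).
  exists (port_vertex e.1) => //; apply: clZ dZ _ (outS _ kl).
  by rewrite vertex_adj_sym.
have [[l1 w1] w1Z lk1] := leave _ _ cl1 xZ1.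
have [[l2 w2] w2Z lk2] := leave _ _ cl2 yZ2.
rewrite sideE // bP // in w1Z.
by apply: (notboth _ _ w2Z); rewrite sideE // bP.
Qed.

Lemma matching_bound l : {subset l <= exits} -> uniq (ports l) ->
  {in l, forall e, (port_vertex e.1 \in S) || (port_vertex e.2 \in S)} -> size l <= #|S|.
Proof.
move=> lex ul hit; pose h := [seq port_vertex p | p <- ports l & port_vertex p \in S].
have le : size l <= size h.
  rewrite size_map size_filter; elim: l hit {lex ul h} => // e l IH hit.
  rewrite /ports /= -addn1 addnC addnA; apply: leq_add; last first.
    by apply: IH => x xl; apply: hit; rewrite inE xl orbT.
  by have := hit e (mem_head _ _); case: (_ \in S) => //= ->.
apply: leq_trans le _; apply: (@leq_trans #|[set x in h]|).
  rewrite cardsE; suff /card_uniqP-> : uniq h by [].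
  rewrite map_inj_in_uniq ?filter_uniq // => p q; rewrite !mem_filter.
  have vp r : r \in ports l -> valid_port r.
    case/flattenP=> _ /mapP[e /lex/exit_adj[v1 v2 _ _] ->].
    by rewrite !inE => /orP[]/eqP->.
  by move=> /andP[_ /vp v1] /andP[_ /vp v2]; apply: port_vertex_inj.
by apply/subset_leq_card/subsetP=> x; rewrite inE => /mapP[p]; rewrite mem_filter => /andP[pS _] ->.
Qed.

(** If [S] had fewer than six vertices, each cluster would lie on one side, apart from [S]. Were all
    clusters on the same side, the other side would be empty; otherwise six disjoint exits join the
    two sides and each has an end in [S]. *)
Lemma no_small_cut Z1 Z2 : cut_side Z1 -> cut_side Z2 -> [disjoint Z1 & Z2] ->
  (forall z, [|| z \in Z1, z \in Z2 | z \in S]) -> Z1 != set0 -> Z2 != set0 -> 6 <= #|S|.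
Proof.
move=> cl1 cl2 d12 cover /set0Pn[[k1 x1] xZ1] /set0Pn[[k2 x2] xZ2].
rewrite leqNgt; apply/negP=> S5.
pose side (k : 'I_9) := [exists x, (k, x) \in Z1].
have sideE k x : (k, x) \notin S -> ((k, x) \in Z1) = side k.
  move=> nS; apply/idP/existsP => [xZ|[y yZ]]; first by exists x.
  have := cover (k, x); rewrite (negPf nS) orbF => /orP[//|x2Z].
  by case: (cluster_unsplit cl1 cl2 d12 S5 yZ x2Z).
pose s := mkseq (fun i => side (inord i)) 9.
have snth p : valid_port p -> nth false s p.1 = side (port_vertex p).1.
  by move=> /andP[p9 _]; rewrite nth_mkseq.
have /allP/(_ s) := exits_cut; rewrite bitseqsP ?size_mkseq // => /(_ isT) /orP[cs|].
  have /(constantP false)[b sb] := cs.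
  have bE k : side k = b.
    have : nth false s k \in s by rewrite mem_nth // size_mkseq.
    by rewrite {2}sb nth_mkseq // inord_val => /nseqP[].
  have side1 : side k1 by apply/existsP; exists x1.
  have nS : (k2, x2) \notin S by apply/negP=> /(cut_side_disjoint cl2 xZ2).
  have := sideE _ _ nS; rewrite bE -(bE k1) side1 => H.
  by have := disjointFr d12 H; rewrite xZ2.
rewrite leqNgt => /negP; apply; apply: leq_ltn_trans S5.
set l := filter _ exits; have lex : {subset greedy_matching l <= exits}.
  by move=> e /greedy_matching_sub; rewrite mem_filter => /andP[].
apply: matching_bound => //.
  apply: greedy_matching_uniq; apply/allP=> e; rewrite mem_filter => /andP[_ /(allP exits_valid)].
  by case/and5P=> _ _ _ _; apply: contraNneq => ->.
move=> e el; have [v1 v2 _ adj] := exit_adj (lex e el).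
have : separated s e by move/greedy_matching_sub: el; rewrite mem_filter => /andP[].
rewrite /separated !snth //; apply: contraR; rewrite negb_or => /andP[n1 n2].
have Zs z : z \notin S -> (z \in Z1) = side z.1 by case: z => k x /sideE.
rewrite -!Zs //; apply/eqP; apply/idP/idP => H; case: cl1 => cl1 _; apply: cl1 H _ _ => //.
by rewrite vertex_adj_sym.
Qed.

End Cut.

Lemma cluster_graph_connected : k_connected vertex_adj 6.
Proof.
apply: k_connectedI; [exact: vertex_adj_sym|exact: vertex_adj_irr| |]; last first.
  by rewrite card_vertex; lia.
move=> A A0 Afull; pose B := ~: (A :|: nbhd vertex_adj A).
apply: (@no_small_cut _ A B) => //.
- split=> [x y xA xy yS|]; last first.
    by rewrite disjoints_subset; apply/subsetP=> x xA; rewrite in_setC in_setD xA.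
  by move: yS; rewrite in_setD (mem_nbhd xA xy) andbT negbK.
- split=> [x y|].
    rewrite !in_setC !in_setU in_setD !negb_or => /andP[xA xN] xy.
    have yA : y \notin A.
      by apply: contra xN => yA; apply: mem_nbhd yA _; rewrite vertex_adj_sym.
    by rewrite yA.
  rewrite disjoints_subset; apply/subsetP=> x; rewrite !in_setC in_setU in_setD negb_or.
  by case/andP=> _ /negPf->; rewrite andbF.
- by rewrite disjoints_subset; apply/subsetP=> x xA; rewrite in_setC in_setC in_setU xA.
- move=> z; rewrite in_setC in_setU in_setD.
  by case: (z \in A); case: (z \in nbhd _ A).
- by apply: contraNneq Afull => B0; rewrite -[X in _ == X]setC0 -B0 setCK.
Qed.

End Graph.

(** * Spanning plane subgraphs *)

Lemma connectivity_le (V : finType) (e : rel V) u v :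
  u != v -> connectivity e <= local_connectivity e u v.
Proof.
move=> uv; rewrite /connectivity; have := mem_index_enum (u, v).
elim: (index_enum _) => // x r IH; rewrite inE big_cons => /orP[/eqP<-|/IH le].
  by rewrite uv geq_minl.
by case: ifP => // _; apply: leq_trans (geq_minr _ _) le.
Qed.

Lemma k_connected_paths (V : finType) (e : rel V) k u v : u != v -> k_connected e k ->
  exists P : {set #|V|.-bseq V}, [/\ k <= #|P|,
    forall s : #|V|.-bseq V, s \in P -> is_uvpath e u v s &
    forall (s t : #|V|.-bseq V) w, s \in P -> t \in P -> w \in s -> w \in t -> s = t].
Proof.
move=> uv /leq_trans/(_ (connectivity_le e uv)); rewrite /local_connectivity.
case: k => [_|k lt]; first by exists set0; split=> // [s|s t w]; rewrite inE.
case: (boolP [exists P : {set #|V|.-bseq V}, ([forall s in P, is_uvpath e u v s] &&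
    internally_disjoint P) && (k < #|P|)]) => [/existsP[P /andP[/andP[/forall_inP pP dP] kP]]|].
  exists P; split=> // s t w sP tP ws wt; apply/eqP; apply: contraTT wt => st.
  have /forall_inP/(_ s sP)/forall_inP/(_ t tP) := dP.
  by rewrite st => d; rewrite (disjointFr d ws).
rewrite negb_exists => /forallP no; move: lt; rewrite leqNgt ltnS => /negP[].
by apply/bigmax_leqP=> P cP; have := no P; rewrite cP /= -leqNgt.
Qed.

Lemma path_leave (V : finType) (e : rel V) (A : pred V) x p :
  path e x p -> A x -> ~~ A (last x p) ->
  exists a b, [/\ a \in belast x p, e a b, A a & ~~ A b].
Proof.
elim: p x => [|y p IH] x /=; first by move=> _ ->.
case/andP=> xy py Ax nA; have [Ay|nAy] := boolP (A y); last first.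
  by exists x, y; rewrite mem_head.
by have [a [b [ap ab Aa nAb]]] := IH y py Ay nA; exists a, b; rewrite inE ap orbT.
Qed.

(** * Exits used by a 3-connected spanning subgraph *)

Section Spanning.
Variables (m : nat) (F : rel (vertex m)).
Hypotheses (F_sym : symmetric F) (F_sub : subrel F (@vertex_adj m)).

Definition used_exits : seq (port * port) :=
  [seq e <- exits | F (port_vertex m e.1) (port_vertex m e.2)].

(** Three internally disjoint paths from the hub of cluster [k] to another hub leave the cluster at
    three different corners. *)
Lemma used_exits_bound (k : 'I_9) : k_connected F 3 ->
  3 <= count (fun p => p.1 == k :> nat) (ports used_exits).
Proof.
move=> F3; have [l lk] : exists l : 'I_9, l != k.
  have [->|ne] := eqVneq k ord0; first by exists ord_max.
  by exists ord0; rewrite eq_sym.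
have uv : (k, None) != (l, None) :> vertex m by rewrite xpair_eqE negb_and eq_sym lk.
have [P [P3 pP dP]] := k_connected_paths uv F3.
pose E := [set c : 'I_6 | (k : nat, c : nat) \in ports used_exits].
apply: (@leq_trans #|E|); last first.
  rewrite cardE -size_filter -(size_map (fun c : 'I_6 => (k : nat, c : nat))).
  apply: uniq_leq_size; first by rewrite map_inj_uniq ?enum_uniq // => a b [/val_inj].
  by move=> p /mapP[c]; rewrite mem_enum inE => cE ->; rewrite mem_filter eqxx.
have ex (s : #|vertex m|.-bseq (vertex m)) : s \in P ->
    exists c, (c \in E) && ((k, Some (ord_max, c)) \in s).
  move=> sP; have /andP[pathP _] := pP s sP.
  have [||a [b [ab Fab /eqP ak bk]]] := path_leave (A := fun x => x.1 == k) pathP; rewrite ?last_rcons //=.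
  have nab : a.1 != b.1 by rewrite ak eq_sym.
  have [e eE eab] := vertex_adj_exit (F_sub Fab) nab.
  have [v1 v2 _ _] := exit_adj m eE.
  have key p : a = port_vertex m p -> p \in ports used_exits -> valid_port p ->
      exists c, (c \in E) && ((k, Some (ord_max, c)) \in s).
    move=> ap pu /andP[p9 p6]; exists (inord p.2); rewrite inE inordK //.
    have kp : k = p.1 :> nat by rewrite -ak ap /= inordK.
    rewrite kp -surjective_pairing pu /=.
    (* The start of the path is a hub and hence no corner, so [a] is an internal vertex. *)
    rewrite belast_rcons inE in ab; case/orP: ab => [/eqP au|].
      by move: ap; rewrite au => -[].
    by rewrite ap /port_vertex -kp inord_val.
  have eu : e \in used_exits.
    by rewrite mem_filter eE andbT; case: eab Fab => -[-> ->] //; rewrite F_sym.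
  have pu p : p \in [:: e.1; e.2] -> p \in ports used_exits.
    by move=> pe; apply/flattenP; exists [:: e.1; e.2] => //; apply/mapP; exists e.
  case: eab => -[ea _]; first by apply: (key e.1); rewrite ?pu ?mem_head.
  by apply: (key e.2); rewrite ?pu // !inE eqxx orbT.
pose g s := odflt ord0 [pick c | (c \in E) && ((k, Some (ord_max, c)) \in (s : #|vertex m|.-bseq (vertex m)))].
have gP s : s \in P -> (g s \in E) && ((k, Some (ord_max, g s)) \in s).
  by move=> sP; rewrite /g; case: pickP => [//|no]; have [c] := ex s sP; rewrite no.
have gI : {in P &, injective g}.
  move=> s t sP tP eq; have /andP[_ gs] := gP s sP; have /andP[_ gt] := gP t tP.
  by apply: (dP _ _ _ sP tP gs); rewrite eq.
apply: leq_trans P3 _; rewrite -(card_in_imset gI); apply/subset_leq_card/subsetP=> _ /imsetP[s sP ->].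
by have /andP[] := gP s sP.
Qed.

Lemma count_ports (A : pred port) (f : pred (port * port)) l :
  count A (ports [seq e <- l | f e]) = sumn [seq f e * (A e.1 + A e.2) | e <- l].
Proof.
elim: l => //= e l <-; case: (f e) => //=.
by rewrite mul1n addnA.
Qed.

(* [two] gives the 2-clause of a cluster, [n1], ..., [n10] being the crossings of
   edges joining the same two clusters. *)
Lemma crossing_choice :
  (forall x, x \in crossings -> ~~ (F (port_vertex m x.1.1) (port_vertex m x.1.2) &&
                                   F (port_vertex m x.2.1) (port_vertex m x.2.2))) ->
  ~ k_connected F 3.
Proof.
move=> cross F3.
pose f (e : port * port) := F (port_vertex m e.1) (port_vertex m e.2).
have cross' : all (fun x => ~~ (f x.1 && f x.2)) crossings by apply/allP.
have deg k : k < 9 -> 3 <= sumn [seq f e * (((e.1.1 == k) : nat) + (e.2.1 == k)) | e <- exits].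
  move=> k9; have := used_exits_bound (Ordinal k9) F3.
  by rewrite /used_exits (count_ports _ f).
move: cross' (deg 0 isT) (deg 1 isT) (deg 2 isT) (deg 3 isT) (deg 4 isT) (deg 5 isT) (deg 6 isT).
rewrite /exits /crossings /= !muln0 ?muln1 !add0n.
have two (a b c d p q : bool) : ~~ (a && b) -> ~~ (c && d) ->
    2 < a + (b + (c + (d + (p + (q + 0))))) -> p || q.
  by case: a; case: b; case: c; case: d; case: p; case: q.
move=> /andP[n1 /andP[n2 /andP[n3 /andP[n4 /andP[n5 /andP[n6 /andP[n7 /andP[n8 /andP[n9 /andP[n10 /andP[n11 /andP[n12 /andP[n13 /andP[n14 /andP[n15 _]]]]]]]]]]]]]]].
move=> /(two _ _ _ _ _ _ n1 n5) c0 /(two _ _ _ _ _ _ n2 n6) c1 /(two _ _ _ _ _ _ n3 n7) c2.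
move=> /(two _ _ _ _ _ _ n3 n4) c3 /(two _ _ _ _ _ _ n1 n8) c4 /(two _ _ _ _ _ _ n2 n9) c5.
move=> /(two _ _ _ _ _ _ n4 n10) c6.
move: n11 n12 n13 n14 n15 c0 c1 c2 c3 c4 c5 c6.
(* Exhaustive check of the seven clauses over the five remaining crossing pairs. *)
case: (f (0, 0, (6, 0))); case: (f (2, 0, (4, 0))) => //=;
case: (f (1, 3, (2, 3))); case: (f (3, 0, (7, 1))) => //=;
case: (f (0, 3, (7, 3))); case: (f (1, 0, (7, 4))) => //=;
case: (f (3, 5, (8, 0))); case: (f (5, 3, (6, 3))) => //=;
by case: (f (4, 3, (8, 4))); case: (f (5, 0, (8, 3))).
Qed.

End Spanning.

(** * Integer coordinates *)

From mathcomp Require Import ssrZ.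
From Stdlib Require Import BinInt.

(* [BinInt] rebinds the delimiter [N], which is used for [nat] in MathComp. *)
Delimit Scope nat_scope with N.

Definition centers : seq (Z * Z) :=
  [:: (21, -23); (16, -7); (29, -7); (24, 3); (-1, -35); (1, 1); (31, 20); (22, -11);
      (-22, 12)]%Z.

(** Each hexagon is listed counterclockwise around its hub. *)
Definition corners : seq (seq (Z * Z)) :=
  [:: [:: (28, -28); (24, -20); (21, -18); (18, -17); (16, -24); (21, -29)];
      [:: (17, -11); (18, -10); (19, -8); (19, -5); (12, -3); (11, -6)];
      [:: (37, -11); (31, -5); (27, -4); (24, -5); (25, -7); (29, -10)];
      [:: (21, 0); (26, -2); (29, -1); (31, 4); (24, 8); (16, 9)];
      [:: (30, -52); (20, -36); (8, -26); (-12, -18); (-23, -27); (-30, -52)];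
      [:: (-6, -6); (4, -4); (7, 1); (6, 10); (-1, 7); (-6, -1)];
      [:: (60, 0); (30, 52); (15, 32); (14, 19); (26, 11); (39, 5)];
      [:: (25, -11); (23, -7); (20, -9); (19, -11); (20, -15); (23, -15)];
      [:: (0, 25); (-30, 52); (-60, 0); (-26, -12); (-11, -2); (-4, 10)]]%Z.

Definition center (k : nat) : Z * Z := nth (0, 0)%Z centers k.

Definition corner (p : port) : Z * Z := nth (0, 0)%Z (nth [::] corners p.1) p.2.

(** * Separating lines in the integer plane *)

Section IntegerPlane.
Local Open Scope Z_scope.

Definition zadd (a b : Z * Z) : Z * Z := (a.1 + b.1, a.2 + b.2).
Definition zsub (a b : Z * Z) : Z * Z := (a.1 - b.1, a.2 - b.2).
Definition zscale (n : Z) (a : Z * Z) : Z * Z := (n * a.1, n * a.2).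
Definition zdet (v w : Z * Z) : Z := v.1 * w.2 - v.2 * w.1.
Definition zdot (v w : Z * Z) : Z := v.1 * w.1 + v.2 * w.2.

(** A line weakly separates the segments [ab] and [cd] and does not contain all four points. Common
    ends are allowed, yet the open segments are disjoint; a segment may degenerate to a point. *)
Definition zsep (a b c d : Z * Z) : Prop := exists (n : Z * Z) (t : Z),
  [/\ zdot n a <= t, zdot n b <= t, t <= zdot n c, t <= zdot n d &
      zdot n a < t \/ zdot n b < t \/ t < zdot n c \/ t < zdot n d].

Lemma zdet_scale r a b c d :
  zdet (zsub (zscale r a) (zscale r b)) (zsub (zscale r c) (zscale r d)) =
  r * r * zdet (zsub a b) (zsub c d).
Proof. by rewrite /zdet /=; lia. Qed.

(** The inequalities say, without division, that the parameter [n / D] of an intersection point lies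
    strictly between 0 and 1. *)
Lemma crossing_scale r n D : 0 < r -> 0 < n * D -> n * D < D * D ->
  0 < (r * r * n) * (r * r * D) /\ (r * r * n) * (r * r * D) < (r * r * D) * (r * r * D).
Proof.
move=> r0 n0 nD; have r2 : 0 < r * r by nia.
have r4 : 0 < r * r * (r * r) by nia.
have -> : r * r * n * (r * r * D) = r * r * (r * r) * (n * D) by lia.
have -> : r * r * D * (r * r * D) = r * r * (r * r) * (D * D) by lia.
by split; nia.
Qed.

Lemma zsep_swapl a b c d : zsep a b c d -> zsep b a c d.
Proof. by case=> n [t [? ? ? ? ?]]; exists n, t; split=> //; tauto. Qed.

Lemma zsep_sym a b c d : zsep a b c d -> zsep c d a b.
Proof.
case=> -[x y] [t]; rewrite /zdot /= => -[? ? ? ? ?]; exists (- x, - y), (- t).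
by rewrite /zdot /=; split; lia.
Qed.

Lemma zsep_swapr a b c d : zsep a b c d -> zsep a b d c.
Proof. by move/zsep_sym/zsep_swapl/zsep_sym. Qed.

Lemma zsep_scale r a b c d : 0 < r -> zsep a b c d ->
  zsep (zscale r a) (zscale r b) (zscale r c) (zscale r d).
Proof.
move=> r0 [n [t [ha hb hc hd st]]]; exists n, (r * t).
have E q : zdot n (zscale r q) = r * zdot n q by rewrite /zdot /=; lia.
rewrite !E; split; nia.
Qed.

(** The normals point to the right of the sides, hence outwards for a hexagon listed
    counterclockwise. *)
Definition edge_lines (l : seq (Z * Z)) : seq ((Z * Z) * Z) :=
  [seq let v := zsub (nth (0, 0) l (i.+1 %% 6)) (nth (0, 0) l i) in
       let n := (v.2, - v.1) in (n, zdot n (nth (0, 0) l i)) | i <- iota 0 6].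

Definition segment_lines (a b : Z * Z) : seq ((Z * Z) * Z) :=
  let v := zsub b a in
  [:: ((v.2, - v.1), zdot (v.2, - v.1) a); ((- v.2, v.1), zdot (- v.2, v.1) a)].

End IntegerPlane.

(** * Finite checks on the coordinates *)

Section Tables.
Local Open Scope Z_scope.

Definition hull (k : nat) : seq (Z * Z) := center k :: nth [::] corners k.

Definition hulls_separated (k l : nat) : bool :=
  has (fun f => all (fun q => zdot f.1 q <=? f.2) (hull k) &&
                all (fun q => f.2 <? zdot f.1 q) (hull l)) (edge_lines (nth [::] corners k)).

Lemma hulls_separatedP : all (fun k => all (fun l =>
    [|| k == l, hulls_separated k l | hulls_separated l k]) (iota 0 9)) (iota 0 9).
Proof. by vm_compute. Qed.

(** Weak inequalities admit exits starting at a corner of cluster [k]; the last clause gives the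
    strictness demanded by [zsep]. *)
Definition exit_outside (k : nat) (e : port * port) : bool :=
  has (fun f => [&& all (fun q => zdot f.1 q <=? f.2) (hull k),
      f.2 <=? zdot f.1 (corner e.1), f.2 <=? zdot f.1 (corner e.2) &
      [|| f.2 <? zdot f.1 (corner e.1), f.2 <? zdot f.1 (corner e.2) |
          all (fun q => zdot f.1 q <? f.2) (hull k)]])
    (edge_lines (nth [::] corners k) ++ segment_lines (corner e.1) (corner e.2)).

Lemma exit_outsideP : all (fun k => all (exit_outside k) exits) (iota 0 9).
Proof. by vm_compute. Qed.

Definition exits_separated (e e' : port * port) : bool :=
  has (fun f => [&& zdot f.1 (corner e.1) <=? f.2, zdot f.1 (corner e.2) <=? f.2,
      f.2 <=? zdot f.1 (corner e'.1), f.2 <=? zdot f.1 (corner e'.2) &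
      [|| zdot f.1 (corner e.1) <? f.2, zdot f.1 (corner e.2) <? f.2,
          f.2 <? zdot f.1 (corner e'.1) | f.2 <? zdot f.1 (corner e'.2)]])
    (segment_lines (corner e.1) (corner e.2) ++ segment_lines (corner e'.1) (corner e'.2)).

(** The other edge in the crossing pair of [e]. Every exit is in such a pair, so the default
    [(e, e)] does not occur for exits. *)
Definition mate_exit (e : port * port) : port * port :=
  let x := nth (e, e) crossings (find (fun x => (x.1 == e) || (x.2 == e)) crossings) in
  if x.1 == e then x.2 else x.1.

Definition exit_direction (e : port * port) : Z * Z := zsub (corner e.2) (corner e.1).

Lemma exits_separatedP : all (fun e => all (fun e' =>
    [|| e == e', exits_separated e e' | e' == mate_exit e]) exits) exits.
Proof. by vm_compute. Qed.

Lemma mate_exitP : all (fun e => [&& mate_exit e \in exits,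
   [&& e.1 != (mate_exit e).1, e.1 != (mate_exit e).2,
       e.2 != (mate_exit e).1 & e.2 != (mate_exit e).2] &
   negb (zdet (exit_direction e) (exit_direction (mate_exit e)) =? 0)]) exits.
Proof. by vm_compute. Qed.

(** By Cramer's rule the two determinants divided by [D] are the parameters of the intersection
    point on the two lines; both lie strictly between 0 and 1. *)
Lemma crossings_cross : all (fun x =>
    let D := zdet (exit_direction x.1) (exit_direction x.2) in
    let u := zsub (corner x.2.1) (corner x.1.1) in
    [&& 0 <? zdet u (exit_direction x.2) * D, zdet u (exit_direction x.2) * D <? D * D,
        0 <? zdet u (exit_direction x.1) * D & zdet u (exit_direction x.1) * D <? D * D])
  crossings.
Proof. by vm_compute. Qed.

Definition spoke (k c : nat) : Z * Z := zsub (corner (k, c)) (center k).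

(** The separating line passes through the hub. Strictness is asked on the first spoke of a sector,
    where each item other than the hub has an end off the hub. *)
Definition sectors_separated (k c d : nat) : bool :=
  let c' := (c.+1 %% 6)%N in let d' := (d.+1 %% 6)%N in
  has (fun n => [&& zdot n (spoke k c) <=? 0, zdot n (spoke k c') <=? 0,
      0 <=? zdot n (spoke k d), 0 <=? zdot n (spoke k d') &
      (zdot n (spoke k c) <? 0) || (0 <? zdot n (spoke k d))])
    (flatten [seq let v := spoke k i in [:: (v.2, - v.1); (- v.2, v.1)] | i <- iota 0 6]).

Lemma sectors_separatedP : all (fun k => all (fun c => all (fun d =>
    (c == d) || sectors_separated k c d) (iota 0 6)) (iota 0 6)) (iota 0 9).
Proof. by vm_compute. Qed.

Lemma sector_det : all (fun k => all (fun c =>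
    0 <? zdet (spoke k c) (spoke k (c.+1 %% 6)%N)) (iota 0 6)) (iota 0 9).
Proof. by vm_compute. Qed.

End Tables.

Local Arguments Z.of_nat : simpl never.
Local Arguments Z.mul : simpl never.
Local Arguments Z.add : simpl never.
Local Arguments Z.sub : simpl never.

(** * Positions of the vertices and separation of the edges *)

Section Positions.
Variable m : nat.
Local Notation vertex := (vertex m).
Implicit Types (k : 'I_9) (c d : 'I_6) (u v x y : vertex).
Local Open Scope Z_scope.

(** Enlarging the picture by the number of rings makes all concentric hexagons integral; the
    outermost ring lands on the scaled corners. *)
Definition scaling : Z := Z.of_nat m.+2.

Definition zpos (x : vertex) : Z * Z :=
  zadd (zscale scaling (center x.1))
    (if x.2 is Some (j, c) then zscale (Z.of_nat j.+1) (spoke x.1 c) else (0, 0)).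

(* The ends of the only edge that may cross the edge [uv]; junk if [uv] is uncrossed. *)
Definition mate (u v : vertex) : vertex * vertex :=
  if u.1 == v.1 then
    match u.2, v.2 with
    | Some (i, c), Some (j, d) => ((u.1, Some (i, d)), (u.1, Some (j, c)))
    | _, _ => (u, v)
    end
  else
    let port_of (x : vertex) := (x.1 : nat, if x.2 is Some (_, c) then c : nat else 0%N) in
    let e := mate_exit (if (u.1 < v.1)%N then (port_of u, port_of v) else (port_of v, port_of u)) in
    (port_vertex m e.1, port_vertex m e.2).

(** Either the open edges are disjoint, or the second edge is the designated partner of the first;
    being non-parallel, they then share at most one point. *)
Definition compatible (u v x y : vertex) : Prop :=
  zsep (zpos u) (zpos v) (zpos x) (zpos y) \/
  [/\ edge_ends (G := cluster_graph m) x y = edge_ends (G := cluster_graph m) (mate u v).1 (mate u v).2,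
      disjoint_edges (G := cluster_graph m) u v x y
    & zdet (zsub (zpos v) (zpos u)) (zsub (zpos y) (zpos x)) <> 0].

Lemma mate_sym u v : edge_ends (G := cluster_graph m) (mate u v).1 (mate u v).2 =
  edge_ends (G := cluster_graph m) (mate v u).1 (mate v u).2.
Proof.
rewrite /edge_ends /mate [v.1 == u.1]eq_sym; case: eqP => [E|/eqP ne] /=.
  by rewrite E; case: (u.2) => [[i c]|]; case: (v.2) => [[j d]|]; rewrite /= setUC.
by case: (ltngtP u.1 v.1) => // E; rewrite -val_eqE /= E eqxx in ne.
Qed.

Lemma compatible_swapl u v x y : compatible u v x y -> compatible v u x y.
Proof.
case=> [s|[e d z]]; [left; exact: zsep_swapl|right].
split; first by rewrite -mate_sym.
  by rewrite /disjoint_edges /edge_ends setUC.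
by move: z; rewrite /zdet /zsub /=; lia.
Qed.

Lemma compatible_swapr u v x y : compatible u v x y -> compatible u v y x.
Proof.
case=> [s|[e d z]]; [left; exact: zsep_swapr|right].
split; first by rewrite -e /edge_ends setUC.
  by rewrite /disjoint_edges /edge_ends [[set y; x]]setUC.
by move: z; rewrite /zdet /zsub /=; lia.
Qed.

Lemma scaling_gt0 : 0 < scaling. Proof. by rewrite /scaling; lia. Qed.

Lemma spokeE k c : corner (k : nat, c : nat) = zadd (center k) (spoke k c).
Proof.
by rewrite /spoke /zadd /zsub /=; case: (corner _) => a b /=; congr pair; lia.
Qed.

Lemma zpos_port (p : port) : valid_port p -> zpos (port_vertex m p) = zscale scaling (corner p).
Proof.
case: p => k c /andP[/= k9 c6]; rewrite /zpos /port_vertex /=.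
have := spokeE (Ordinal k9) (Ordinal c6); rewrite /= !inordK // => ->.
by rewrite /scaling /zadd /zscale /=; congr pair; lia.
Qed.

Lemma mem_hull k c : corner (k : nat, c : nat) \in hull k.
Proof.
have sz : size (nth [::] corners k) = 6%N by case: k => [[|[|[|[|[|[|[|[|[|//]]]]]]]]] ?].
by rewrite inE /corner mem_nth ?orbT //= sz.
Qed.

(** Up to the scaling, each vertex of a cluster is a convex combination of the hub and a corner, so
    linear bounds on the seven points of [hull k] carry over to the whole cluster. *)
Lemma zdot_zpos (n : Z * Z) k (z : cluster_vertex m) : exists2 J : Z, 0 <= J <= scaling &
  exists2 q, q \in hull k & zdot n (zpos (k, z)) = (scaling - J) * zdot n (center k) + J * zdot n q.
Proof.
case: z => [[j c]|]; last first.
  exists 0; first by have := scaling_gt0; lia.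
  by exists (center k); rewrite ?mem_head // /zpos /zdot /=; lia.
exists (Z.of_nat j.+1); first by have := ltn_ord j; rewrite /scaling; lia.
exists (corner (k : nat, c : nat)); first exact: mem_hull.
by rewrite spokeE /zpos /zdot /zadd /zscale /=; lia.
Qed.

Lemma zpos_hull (n : Z * Z) t k (z : cluster_vertex m) :
  (forall q, q \in hull k -> zdot n q <= t) -> zdot n (zpos (k, z)) <= scaling * t.
Proof.
move=> H; have [J J0 [q /H hq ->]] := zdot_zpos n k z.
by have := H (center k) (mem_head _ _); nia.
Qed.

Lemma zdotN (n q : Z * Z) : zdot (- n.1, - n.2) q = - zdot n q.
Proof. by rewrite /zdot /=; lia. Qed.

Lemma zpos_hull_lt (n : Z * Z) t k (z : cluster_vertex m) :
  (forall q, q \in hull k -> zdot n q < t) -> zdot n (zpos (k, z)) < scaling * t.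
Proof.
move=> H; have r0 := scaling_gt0.
(* Over the integers, being less than [t] means being at most [t - 1]. *)
have : zdot n (zpos (k, z)) <= scaling * (t - 1) by apply: zpos_hull => q /H; lia.
by nia.
Qed.

Lemma zpos_hull_gt (n : Z * Z) t k (z : cluster_vertex m) :
  (forall q, q \in hull k -> t < zdot n q) -> scaling * t < zdot n (zpos (k, z)).
Proof.
move=> H; have : zdot (- n.1, - n.2) (zpos (k, z)) < scaling * - t.
  by apply: zpos_hull_lt => q /H; rewrite zdotN; lia.
by rewrite zdotN; lia.
Qed.

Lemma clusters_compatible k k' (a b a' b' : cluster_vertex m) : k != k' ->
  compatible (k, a) (k, b) (k', a') (k', b').
Proof.
move=> kk'; left; have r0 := scaling_gt0.
have key (l l' : 'I_9) (p q p' q' : cluster_vertex m) : hulls_separated l l' ->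
    zsep (zpos (l, p)) (zpos (l, q)) (zpos (l', p')) (zpos (l', q')).
  case/hasP=> f _ /andP[/allP le /allP gt]; exists f.1, (scaling * f.2).
  have hle z : zdot f.1 (zpos (l, z)) <= scaling * f.2.
    by apply: zpos_hull => ? /le /Z.leb_le.
  have hgt z : scaling * f.2 < zdot f.1 (zpos (l', z)).
    by apply: zpos_hull_gt => ? /gt /Z.ltb_lt.
  by have := hgt p'; have := hgt q'; split=> //; lia.
have /allP/(_ k) := hulls_separatedP; rewrite mem_iota ltn_ord => /(_ isT).
move/allP/(_ k'); rewrite mem_iota ltn_ord => /(_ isT) /or3P[/eqP/val_inj E|h|h].
- by rewrite E eqxx in kk'.
- exact: key.
- by apply: zsep_sym; exact: key.
Qed.

Lemma exit_compatible k (a b : cluster_vertex m) e : e \in exits ->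
  zsep (zpos (k, a)) (zpos (k, b)) (zpos (port_vertex m e.1)) (zpos (port_vertex m e.2)).
Proof.
move=> eE; have [v1 v2 _ _] := exit_adj m eE; have r0 := scaling_gt0.
rewrite !zpos_port //.
have /allP/(_ k) := exit_outsideP; rewrite mem_iota ltn_ord => /(_ isT).
move/allP/(_ e eE)/hasP => [f _] /and4P[/allP le /Z.leb_le h1 /Z.leb_le h2 st].
have E q : zdot f.1 (zscale scaling q) = scaling * zdot f.1 q by rewrite /zdot /=; lia.
have hle z : zdot f.1 (zpos (k, z)) <= scaling * f.2.
  by apply: zpos_hull => q /le /Z.leb_le.
exists f.1, (scaling * f.2); rewrite !E; have mono p q : p <= q -> scaling * p <= scaling * q by move: r0; clear; nia.
have smono p q : p < q -> scaling * p < scaling * q by move: r0; clear; nia.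
split; [exact: hle|exact: hle|exact: mono|exact: mono|].
case/or3P: st => [/Z.ltb_lt ?|/Z.ltb_lt ?|/allP lt].
- by right; right; left; exact: smono.
- by right; right; right; exact: smono.
by left; apply: zpos_hull_lt => q /lt /Z.ltb_lt.
Qed.

Lemma exits_compatible e e' : e \in exits -> e' \in exits -> e != e' ->
  compatible (port_vertex m e.1) (port_vertex m e.2) (port_vertex m e'.1) (port_vertex m e'.2).
Proof.
move=> eE eE' ne; have [v1 v2 k12 _] := exit_adj m eE; have [v1' v2' _ _] := exit_adj m eE'.
have r0 := scaling_gt0; rewrite /compatible !zpos_port //.
have /allP/(_ e eE)/allP/(_ e' eE') := exits_separatedP; rewrite (negPf ne) /=.
case/orP=> [/hasP[f _]|/eqP e'E].
  case/and5P=> /Z.leb_le ? /Z.leb_le ? /Z.leb_le ? /Z.leb_le ? st.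
  left; apply: zsep_scale => //; exists f.1, f.2; split=> //.
  by case/or4P: st => /Z.ltb_lt; tauto.
right; have /and3P[_ dis /negP nz] := allP mate_exitP e eE; rewrite -e'E in dis nz.
(* Exits list the smaller cluster first, which is the order used by [mate]. *)
have ltk : (e.1.1 < e.2.1)%N.
  by have /allP/(_ e eE) : all (fun e => e.1.1 < e.2.1)%N exits by [].
have pE p : valid_port p -> ((port_vertex m p).1 : nat, (inord p.2 : 'I_6) : nat) = p.
  by case: p => k c /andP[/= k9 c6]; rewrite !inordK.
have ltk' : ((port_vertex m e.1).1 < (port_vertex m e.2).1)%N.
  by move: v1 v2 => /andP[k9 _] /andP[l9 _]; rewrite /= !inordK.
split.
- by rewrite /mate (negPf k12) ltk' /= !pE // -surjective_pairing -e'E.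
- rewrite /disjoint_edges /edge_ends disjoint_sym disjoints_subset; apply/subsetP=> z.
  rewrite !inE negb_or => zE.
  have inj p q : valid_port p -> valid_port q -> p != q -> port_vertex m p != port_vertex m q.
    by move=> vp vq; apply: contra => /eqP/port_vertex_inj-> //.
  case/and4P: dis => d1 d2 d3 d4.
  by case/orP: zE => /eqP->; rewrite !inj // eq_sym.
- rewrite zdet_scale -/(exit_direction e) -/(exit_direction e').
  by move/Z.mul_eq_0=> [|/Z.eqb_eq//]; move: r0; clear; nia.
Qed.

(* A vertex or edge of a cluster lies in the sector of two consecutive spokes;
   [item_coords] gives its end points in the basis formed by these spokes. *)
Inductive item := Hub | Node of nat | Link | Ring of nat | Spoke of nat | Diag of nat | Anti of nat.

Definition node (j : nat) (c : 'I_6) : cluster_vertex m := Some (inord j, c).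

Definition item_valid (it : item) : bool :=
  match it with
  | Hub | Link => true
  | Node j | Ring j => (j < m.+2)%N
  | Spoke j | Diag j | Anti j => (j < m.+1)%N
  end.

Definition item_ends (c : 'I_6) (it : item) : cluster_vertex m * cluster_vertex m :=
  match it with
  | Hub => (None, None)
  | Node j => (node j c, node j c)
  | Link => (node 0 c, None)
  | Ring j => (node j c, node j (c + 1)%R)
  | Spoke j => (node j c, node j.+1 c)
  | Diag j => (node j c, node j.+1 (c + 1)%R)
  | Anti j => (node j.+1 c, node j (c + 1)%R)
  end.

Definition item_coords (it : item) : (Z * Z) * (Z * Z) :=
  let z := Z.of_nat in
  match it with
  | Hub => ((0, 0), (0, 0))
  | Node j => ((z j.+1, 0), (z j.+1, 0))
  | Link => ((1, 0), (0, 0))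
  | Ring j => ((z j.+1, 0), (0, z j.+1))
  | Spoke j => ((z j.+1, 0), (z j.+2, 0))
  | Diag j => ((z j.+1, 0), (0, z j.+2))
  | Anti j => ((z j.+2, 0), (0, z j.+1))
  end.

Definition sector_point k c (st : Z * Z) : Z * Z :=
  zadd (zscale scaling (center k))
    (zadd (zscale st.1 (spoke k c)) (zscale st.2 (spoke k (c.+1 %% 6)%N))).

Lemma val_I6S c : ((c + 1)%R : nat) = (c.+1 %% 6)%N.
Proof. by case: c => [[|[|[|[|[|[|//]]]]]] ?]. Qed.

Lemma zpos_item k c it : item_valid it ->
  zpos (k, (item_ends c it).1) = sector_point k c (item_coords it).1 /\
  zpos (k, (item_ends c it).2) = sector_point k c (item_coords it).2.
Proof.
have hub : zpos (k, None) = sector_point k c (0, 0).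
  by rewrite /zpos /sector_point /zadd /zscale /=; congr pair; lia.
have ndE j d : (j < m.+2)%N -> zpos (k, node j d) =
    zadd (zscale scaling (center k)) (zscale (Z.of_nat j.+1) (spoke k d)).
  by move=> jm; rewrite /zpos /node /= inordK.
have nd j : (j < m.+2)%N -> zpos (k, node j c) = sector_point k c (Z.of_nat j.+1, 0).
  by move/ndE->; rewrite /sector_point /zadd /zscale /=; congr pair; lia.
have nd' j : (j < m.+2)%N -> zpos (k, node j (c + 1)%R) = sector_point k c (0, Z.of_nat j.+1).
  by move/ndE->; rewrite val_I6S /sector_point /zadd /zscale /=; congr pair; lia.
by case: it => [|j||j|j|j|j] /= jm; rewrite ?hub ?nd ?nd' // ltnW.
Qed.

(** A separating line may be given in the basis of the two spokes, since their determinant is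
    positive. *)
Lemma sector_zsep k c (a b a' b' : Z * Z) (n : Z * Z) t :
  zdot n a <= t -> zdot n b <= t -> t <= zdot n a' -> t <= zdot n b' ->
  zdot n a < t \/ zdot n b < t \/ t < zdot n a' \/ t < zdot n b' ->
  zsep (sector_point k c a) (sector_point k c b) (sector_point k c a') (sector_point k c b').
Proof.
move=> ha hb ha' hb' st.
set q := spoke k c; set q' := spoke k (c.+1 %% 6)%N; pose D := zdet q q'.
have D0 : 0 < D.
  have /allP/(_ k) := sector_det; rewrite mem_iota ltn_ord => /(_ isT).
  by move/allP/(_ c); rewrite mem_iota ltn_ord => /(_ isT)/Z.ltb_lt.
(* The functional with values [D * n.1] and [D * n.2] on the two spokes. *)
pose f : Z * Z := (n.1 * q'.2 - n.2 * q.2, n.2 * q.1 - n.1 * q'.1).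
pose C := zdot f (zscale scaling (center k)).
have E p : zdot f (sector_point k c p) = C + D * zdot n p.
  rewrite /C /D /f /sector_point -/q -/q' /zdot /zadd /zscale /zdet /=; lia.
exists f, (C + D * t); rewrite !E; clearbody C D; split; nia.
Qed.

Lemma sectors_compatible k c d it it' : c != d -> item_valid it -> item_valid it' ->
  it <> Hub -> it' <> Hub ->
  compatible (k, (item_ends c it).1) (k, (item_ends c it).2)
             (k, (item_ends d it').1) (k, (item_ends d it').2).
Proof.
move=> cd v v' nh nh'; left.
have [-> ->] := zpos_item k c v; have [-> ->] := zpos_item k d v'.
have /allP/(_ k) := sectors_separatedP; rewrite mem_iota ltn_ord => /(_ isT).
move/allP/(_ c); rewrite mem_iota ltn_ord => /(_ isT).
move/allP/(_ d); rewrite mem_iota ltn_ord => /(_ isT) /orP[/eqP/val_inj E|].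
  by rewrite E eqxx in cd.
case/hasP=> n _ /and5P[/Z.leb_le h1 /Z.leb_le h2 /Z.leb_le h3 /Z.leb_le h4 h5].
(* The first end lies on the first spoke away from the hub, the second in the closed sector. *)
have st i : i <> Hub ->
    0 < (item_coords i).1.1 /\ (item_coords i).1.2 = 0 /\
    0 <= (item_coords i).2.1 /\ 0 <= (item_coords i).2.2.
  by case: i => [|j||j|j|j|j] //= _; lia.
pose C := zdot n (zscale scaling (center k)).
have E e p : zdot n (sector_point k e p) =
    C + p.1 * zdot n (spoke k e) + p.2 * zdot n (spoke k (e.+1 %% 6)%N).
  by rewrite /C /sector_point /zdot /zadd /zscale /=; lia.
exists n, C; rewrite !E; move: (st it nh) (st it' nh') h5.
clearbody C; move: h1 h2 h3 h4.
set x1 := zdot n _; set x2 := zdot n _; set x3 := zdot n _; set x4 := zdot n _.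
move=> h1 h2 h3 h4 [p1 [-> [p2 p3]]] [q1 [-> [q2 q3]]] h5; split; try nia.
Qed.

(** The smaller and the larger value of the sum of the two sector coordinates at the ends. *)
Definition item_level (it : item) : nat * nat :=
  match it with
  | Hub => (0, 0)
  | Link => (0, 1)
  | Node j | Ring j => (j.+1, j.+1)
  | Spoke j | Diag j | Anti j => (j.+1, j.+2)
  end%N.

Lemma level_zsep k c it it' : item_valid it -> item_valid it' ->
  ((item_level it).2 <= (item_level it').1)%N ->
  [|| (item_level it).1 < (item_level it).2, (item_level it').1 < (item_level it').2 |
      (item_level it).2 < (item_level it').1]%N ->
  zsep (zpos (k, (item_ends c it).1)) (zpos (k, (item_ends c it).2))
       (zpos (k, (item_ends c it').1)) (zpos (k, (item_ends c it').2)).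
Proof.
move=> v v' le st; have [-> ->] := zpos_item k c v; have [-> ->] := zpos_item k c v'.
apply: (@sector_zsep k c _ _ _ _ (1, 1) (Z.of_nat (item_level it).2)); move: le st {v v'}.
all: by case: it => [|j||j|j|j|j]; case: it' => [|j'||j'|j'|j'|j']; rewrite /zdot /=; lia.
Qed.

Lemma node_inj j j' c d : (j < m.+2)%N -> (j' < m.+2)%N ->
  (node j c == node j' d) = (j == j') && (c == d).
Proof.
move=> jm jm'; rewrite /node -[in RHS](inordK jm) -[in RHS](inordK jm') !inordK //.
apply/eqP/andP => [[e ->]|[/eqP-> /eqP-> //]].
by split=> //; apply/eqP; rewrite -(inordK jm) -(inordK jm') e.
Qed.

Lemma diag_anti_compatible k c j : (j < m.+1)%N ->
  compatible (k, node j c) (k, node j.+1 (c + 1)%R) (k, node j.+1 c) (k, node j (c + 1)%R) /\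
  compatible (k, node j.+1 c) (k, node j (c + 1)%R) (k, node j c) (k, node j.+1 (c + 1)%R).
Proof.
move=> jm; have jm2 := ltnW jm.
have [vD vA] : item_valid (Diag j) /\ item_valid (Anti j) by [].
have [/= d1 d2] := zpos_item k c vD; have [/= a1 a2] := zpos_item k c vA.
set q := spoke k c; set q' := spoke k (c.+1 %% 6)%N.
have D0 : 0 < zdet q q'.
  have /allP/(_ k) := sector_det; rewrite mem_iota ltn_ord => /(_ isT).
  by move/allP/(_ c); rewrite mem_iota ltn_ord => /(_ isT)/Z.ltb_lt.
have nc : (c == c + 1)%R = false by have := ring_step_irr c; rewrite /ring_step orbb.
have nj : (j == j.+1) = false by apply/eqP; lia.
have nz n : n <> 0 -> zdet q q' * n <> 0 by move: D0; clear; nia.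
have ncS : (c + 1 == c)%R = false by rewrite eq_sym.
have njS : (j.+1 == j) = false by rewrite eq_sym.
have E a b a' b' : zdet (zsub (sector_point k c b) (sector_point k c a))
    (zsub (sector_point k c b') (sector_point k c a')) = zdet q q' * zdet (zsub b a) (zsub b' a').
  by rewrite /sector_point -/q -/q' /zdet /zsub /zscale /zadd /=; lia.
have ij : (inord j == inord j.+1 :> 'I_m.+2) = false.
  by apply/negbTE; rewrite -val_eqE /= !inordK // nj.
split; right; split.
- by rewrite /mate /= eqxx /= /edge_ends setUC.
- rewrite /disjoint_edges /edge_ends disjoints_subset; apply/subsetP=> z.
  by rewrite !inE => /orP[]/eqP->; rewrite !xpair_eqE eqxx !node_inj // ?nj ?njS ?nc ?ncS ?andbF.
(* In the basis of the spokes the directions of the diagonals have determinant [2 * j + 3]. *)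
- by rewrite d1 d2 a1 a2 E; apply: nz; rewrite [zdet _ _]/zdet /zsub /=; lia.
- by rewrite /mate /= eqxx /= /edge_ends setUC.
- rewrite /disjoint_edges /edge_ends disjoints_subset; apply/subsetP=> z.
  by rewrite !inE => /orP[]/eqP->; rewrite !xpair_eqE eqxx !node_inj // ?nj ?njS ?nc ?ncS ?andbF.
- by rewrite d1 d2 a1 a2 E; apply: nz; rewrite [zdet _ _]/zdet /zsub /=; lia.
Qed.

(** Items at different levels are separated by a line parallel to the hexagon side. In the same
    layer the line of the spoke separates it from both diagonals, and the two diagonals are
    mates. *)
Lemma sector_compatible k c it it' : item_valid it -> item_valid it' -> it <> it' ->
  (forall j, ~ (it = Node j /\ it' = Ring j)) -> (forall j, ~ (it = Ring j /\ it' = Node j)) ->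
  compatible (k, (item_ends c it).1) (k, (item_ends c it).2)
             (k, (item_ends c it').1) (k, (item_ends c it').2).
Proof.
move=> v v' ne nr rn.
case lev: (((item_level it).2 <= (item_level it').1) &&
  [|| (item_level it).1 < (item_level it).2, (item_level it').1 < (item_level it').2 |
      (item_level it).2 < (item_level it').1])%N.
  by left; case/andP: lev; exact: level_zsep.
case lev': (((item_level it').2 <= (item_level it).1) &&
  [|| (item_level it').1 < (item_level it').2, (item_level it).1 < (item_level it).2 |
      (item_level it').2 < (item_level it).1])%N.
  by left; apply: zsep_sym; case/andP: lev'; exact: level_zsep.
have par n i i' : item_valid i -> item_valid i' ->
    i = Spoke n -> i' = Diag n \/ i' = Anti n ->
    zsep (zpos (k, (item_ends c i).1)) (zpos (k, (item_ends c i).2))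
       (zpos (k, (item_ends c i').1)) (zpos (k, (item_ends c i').2)).
  move=> w w' E [] E'; have [-> ->] := zpos_item k c w; have [-> ->] := zpos_item k c w';
    by apply: (@sector_zsep k c _ _ _ _ (0, 1) 0); rewrite ?E ?E' /zdot /=; lia.
have [da ad] : (forall j, (j < m.+1)%N -> compatible _ _ _ _) /\ (forall j, (j < m.+1)%N -> compatible _ _ _ _) :=
  conj (fun j jm => proj1 (@diag_anti_compatible k c j jm)) (fun j jm => proj2 (@diag_anti_compatible k c j jm)).
move: v v' ne nr rn lev lev'.
case: it => [|j||j|j|j|j]; case: it' => [|j'||j'|j'|j'|j'] //= v v' ne nr rn lev lev';
  try (by exfalso; lia);
  (have E : j = j' by lia); subst j'; try (by exfalso; apply: ne);
  try (by exfalso; apply: (nr j)); try (by exfalso; apply: (rn j)).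
- by left; apply: (par j (Spoke j) (Diag j)) => //; left.
- by left; apply: (par j (Spoke j) (Anti j)) => //; right.
- by left; apply: zsep_sym; apply: (par j (Spoke j) (Diag j)) => //; left.
- exact: da.
- by left; apply: zsep_sym; apply: (par j (Spoke j) (Anti j)) => //; right.
- exact: ad.
Qed.

End Positions.

(** * Separation of arbitrary vertices and edges *)

Section Drawing.
Variable m : nat.
Local Notation vertex := (vertex m).

Lemma cluster_edge_item (a b : cluster_vertex m) : cluster_adj a b ->
  exists c it, [/\ item_valid m it, it <> Hub, forall j, it <> Node j &
    (a, b) = item_ends m c it \/ (b, a) = item_ends m c it].
Proof.
have nodeE (j : 'I_m.+2) c : Some (j, c) = node m j c by rewrite /node inord_val.
have lt (i j : 'I_m.+2) : j = i.+1 :> nat -> (i < m.+1)%N by have := ltn_ord j; lia.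
case: a b => [[i c]|] [[j d]|] //=; rewrite ?nodeE.
- case/orP=> [/andP[/eqP-> /orP[/eqP->|/eqP->]]|].
  + by exists c, (Ring j); split=> //=; left.
  + by exists d, (Ring j); split=> //=; right.
  case/andP=> /orP[] /eqP E /or3P[] /eqP F; rewrite E F.
  + by exists d, (Spoke i); split=> //=; [exact: lt E|left].
  + by exists c, (Diag i); split=> //=; [exact: lt E|left].
  + by exists d, (Anti i); split=> //=; [exact: lt E|right].
  + by exists d, (Spoke j); split=> //=; [exact: lt E|right].
  + by exists c, (Anti j); split=> //=; [exact: lt E|left].
  + by exists d, (Diag j); split=> //=; [exact: lt E|right].
- by move/eqP->; exists c, Link; split=> //; left.
- by move/eqP->; exists d, Link; split=> //; right.
Qed.

(** The hub belongs to every sector; [d] is the one chosen for it. *)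
Definition sector (a : cluster_vertex m) (d : 'I_6) : 'I_6 := if a is Some (_, c) then c else d.

Lemma cluster_vertex_item (a : cluster_vertex m) d :
  exists it, [/\ item_valid m it, (a, a) = item_ends m (sector a d) it,
    it = Hub -> a = None & forall j, it <> Ring j].
Proof.
case: a => [[j c]|]; last by exists Hub; split.
by exists (Node j); split; rewrite //= /node inord_val.
Qed.

(** A degenerate segment has determinant zero, which leaves only separation. *)
Lemma compatible_vertex (u v w : vertex) :
  compatible u v w w -> zsep (zpos u) (zpos v) (zpos w) (zpos w).
Proof. by case=> // -[_ _ []]; rewrite /zdet /zsub /=; lia. Qed.

Lemma edge_compatible (u v x y : vertex) : vertex_adj u v -> vertex_adj x y ->
  edge_ends (G := cluster_graph m) u v <> edge_ends (G := cluster_graph m) x y -> compatible u v x y.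
Proof.
have swap_ends (p q : vertex) : edge_ends (G := cluster_graph m) p q = edge_ends (G := cluster_graph m) q p.
  by rewrite /edge_ends setUC.
have inner_exit k a b e : e \in exits ->
    compatible (k, a) (k, b) (port_vertex m e.1) (port_vertex m e.2).
  by move=> eE; left; exact: exit_compatible.
have exit_inner k a b e : e \in exits ->
    compatible (port_vertex m e.1) (port_vertex m e.2) (k, a) (k, b).
  by move=> eE; left; apply: zsep_sym; exact: exit_compatible.
move=> uv xy ne; have [euv|/vertex_adj_exit-/(_ uv)] := eqVneq u.1 v.1; last first.
  move=> [e eE E]; have [exy|/vertex_adj_exit-/(_ xy)] := eqVneq x.1 y.1.
    case: x y exy {xy ne} => k a [l b] /= <-.
    by case: E => -[-> ->]; [|apply: compatible_swapl]; exact: exit_inner.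
  move=> [e' eE' E'].
  have nee : e != e'.
    apply: contra_not_neq ne => ee; rewrite -ee in E'.
    by case: E => -[-> ->]; case: E' => -[-> ->].
  have := exits_compatible m eE eE' nee => H.
  by case: E => -[-> ->]; case: E' => -[-> ->] //; [apply: compatible_swapr|
    apply: compatible_swapl|apply: compatible_swapl; apply: compatible_swapr].
have [exy|/vertex_adj_exit-/(_ xy)] := eqVneq x.1 y.1; last first.
  move=> [e eE E]; case: u v euv {uv ne} => k a [l b] /= <-.
  by case: E => -[-> ->]; [|apply: compatible_swapr]; exact: inner_exit.
case: u v euv uv ne => k a [l b] /= <-; case: x y exy xy => k' a' [l' b'] /= <-.
rewrite /vertex_adj !eqxx => /= ab' ab ne.
have [kk|] := eqVneq k k'; last exact: clusters_compatible.
have [c [it [v nh nn E]]] := cluster_edge_item ab.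
have [d [it' [v' nh' nn' E']]] := cluster_edge_item ab'.
rewrite -kk in ne *.
have : compatible (k, (item_ends m c it).1) (k, (item_ends m c it).2)
             (k, (item_ends m d it').1) (k, (item_ends m d it').2).
  have [cd|cd] := eqVneq c d; last exact: sectors_compatible.
  rewrite -cd in E' *; apply: sector_compatible => //.
  - move=> ii; rewrite -ii in E'; apply: ne.
    by case: E => E; case: E' => E'; move: E'; rewrite -E => -[-> ->].
  - by move=> j [/nn].
  - by move=> j [_ /nn'].
case: E E' => <- [] <- //=; [exact: compatible_swapr|exact: compatible_swapl|].
by move=> ?; apply: compatible_swapl; apply: compatible_swapr.
Qed.

Lemma vertex_edge_sep (u v w : vertex) : vertex_adj u v -> w <> u -> w <> v ->
  zsep (zpos u) (zpos v) (zpos w) (zpos w).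
Proof.
move=> uv wu wv; have [euv|/vertex_adj_exit-/(_ uv)] := eqVneq u.1 v.1; last first.
  move=> [e eE E]; have H := exit_compatible w.1 w.2 w.2 eE.
  rewrite -surjective_pairing in H; move/zsep_sym: H.
  by case: E => -[-> ->] //; exact: zsep_swapl.
case: w wu wv => k' w wu wv.
case: u v euv uv wu wv => k a [l b] /= <-; rewrite /vertex_adj eqxx /= => ab wa wb.
apply: compatible_vertex; have [kk|] := eqVneq k k'; last exact: clusters_compatible.
rewrite -kk in wa wb *.
have [c [it [v nh nn E]]] := cluster_edge_item ab.
(* A hub is put into the sector of the edge, so if the sectors differ, [w] is not the hub. *)
have [it' [v' E' hub' nr']] := cluster_vertex_item w c.
set d := sector w c in E'.
have : compatible (k, (item_ends m c it).1) (k, (item_ends m c it).2)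
             (k, (item_ends m d it').1) (k, (item_ends m d it').2).
  have [cd|cd] := eqVneq c d.
    rewrite -cd in E' *; apply: sector_compatible => //.
    - move=> ii; rewrite -ii in E'; apply: wa.
      by case: E; rewrite -E' => -[e1 e2]; rewrite ?e1 ?e2.
    - by move=> j [/nn].
    - move=> j [itj itj']; rewrite itj itj' /= in E E'; case: E' => wE _.
      by case: E => -[aE bE]; [apply: wa|apply: wb]; rewrite wE ?aE ?bE.
  apply: sectors_compatible => // /hub' wN.
  by rewrite /d wN /sector eqxx in cd.
by case: E; rewrite -E' => <- //=; exact: compatible_swapl.
Qed.

Lemma zpos_inj : injective (@zpos m).
Proof.
have differ (p q : Z * Z) : zsep p p q q -> p <> q.
  by case=> n [t [h1 h2 h3 h4 st]] E; move: h1 h3 st; rewrite E; lia.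
move=> [k a] [k' b] E; apply/eqP; apply: contraT => ne.
suff /compatible_vertex/differ[] : compatible (k, a) (k, a) (k', b) (k', b) by [].
have [kk|] := eqVneq k k'; last exact: clusters_compatible.
rewrite -kk in ne *.
(* A hub takes the sector of the other vertex; different sectors thus mean that neither vertex is
   the hub. *)
set c := sector a (sector b ord0); set d := sector b c.
have [it [v Ea hub nr]] := cluster_vertex_item a (sector b ord0).
have [it' [v' Eb hub' nr']] := cluster_vertex_item b c.
rewrite -/c -/d in Ea Eb.
suff : compatible (k, (item_ends m c it).1) (k, (item_ends m c it).2)
             (k, (item_ends m d it').1) (k, (item_ends m d it').2) by rewrite -Ea -Eb.
have [cd|cd] := eqVneq c d.
  rewrite -cd in Eb *; apply: sector_compatible => //.
  - move=> ii; rewrite -ii -Ea in Eb; case: Eb => ba.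
    by rewrite ba eqxx in ne.
  - by move=> j [_ /nr'].
  - by move=> j [/nr].
apply: sectors_compatible => //; first by move/hub=> aN; move: cd; rewrite /d /c aN; case: (b) => [[? ?]|] //=; rewrite eqxx.
by move/hub'=> bN; move: cd; rewrite /d bN /= eqxx.
Qed.

End Drawing.

(** * Straight-line drawings in the real plane *)

From mathcomp Require Import ring lra.
From mathcomp Require Import all_classical all_reals all_analysis.

Import Order.TTheory GRing.Theory Num.Theory.
Import numFieldNormedType.Exports.

Local Open Scope classical_set_scope.
Local Open Scope ring_scope.

Section Segments.
Variable R : realType.
Local Notation plane := (R * R)%type.
Implicit Types a b c d p q : plane.

Definition line_point a b (t : R) : plane := (a.1 + t * (b.1 - a.1), a.2 + t * (b.2 - a.2)).

Definition segment a b : set plane := line_point a b @` `[0, 1].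

Definition det (v w : plane) : R := v.1 * w.2 - v.2 * w.1.

Lemma pair_continuous (T : topologicalType) (f g : T -> R) :
  continuous f -> continuous g -> continuous (fun x => (f x, g x)).
Proof.
move=> cf cg x.
exact: (@cvg_pair _ _ _ _ (nbhs (f x)) (nbhs (g x)) _ _ _ f g (cf x) (cg x)).
Qed.

Lemma affine_continuous (x y z : R) : continuous (fun q : plane => x * q.1 + y * q.2 + z).
Proof.
move=> q; apply: cvgD; last exact: cvg_cst.
by apply: cvgD; apply: cvgM; try exact: cvg_cst; [exact: cvg_fst|exact: cvg_snd].
Qed.

Lemma line_point_continuous a b : continuous (line_point a b).
Proof.
by apply: pair_continuous => t; apply: cvgD; try exact: cvg_cst;
  apply: cvgM; try exact: cvg_cst; exact: cvg_id.
Qed.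

Lemma segment_sym a b : segment a b = segment b a.
Proof.
have half c d : segment c d `<=` segment d c.
  move=> _ [t t01 <-]; exists (1 - t).
    by move: t01; rewrite /= !in_itv /=; lra.
  by rewrite /line_point; congr pair; ring.
by apply/seteqP; split; exact: half.
Qed.

Lemma segment_arc a b : a != b -> is_arc (segment a b) a b.
Proof.
move=> ab; exists (line_point a b); split=> //.
- exact/continuous_subspaceT/line_point_continuous.
- move=> s t _ _ [e1 e2]; apply/eqP; rewrite -subr_eq0; apply: contraNT ab => st.
  have f1 : (s - t) * (b.1 - a.1) = 0 by move: e1; lra.
  have f2 : (s - t) * (b.2 - a.2) = 0 by move: e2; lra.
  move/eqP: f1; move/eqP: f2; rewrite !mulf_eq0 (negPf st) /= !subr_eq0.
  by case: (a) (b) => [? ?] [? ?] /= /eqP-> /eqP->.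
- by rewrite /line_point; case: (a) => ? ? /=; congr pair; ring.
- by rewrite /line_point; case: (b) => ? ? /=; congr pair; ring.
Qed.

(** The open segment; for [a = b] it is the point [a], so vertices can be treated as degenerate
    edges. *)
Definition between a b p : Prop := exists2 t : R, 0 < t < 1 & p = line_point a b t.

Lemma between_refl a : between a a a.
Proof.
exists 2^-1; first by apply/andP; split; lra.
by rewrite /line_point; case: a => ? ? /=; congr pair; ring.
Qed.

Lemma segment_interior a b p : (segment a b `\` [set a; b]) p -> between a b p.
Proof.
move=> [[t]]; rewrite /= in_itv /= => /andP[t0 t1] <- nab; exists t => //.
rewrite !lt_neqAle t0 t1 !andbT; apply/andP; split; apply/eqP => E; apply: nab.
  by left; rewrite -E /line_point; case: (a) => ? ? /=; congr pair; ring.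
by right; rewrite E /line_point; case: (b) => ? ? /=; congr pair; ring.
Qed.

Lemma between_interior a b p : a != b -> between a b p -> (segment a b `\` [set a; b]) p.
Proof.
move=> ab [t /andP[t0 t1] ->]; split.
  by exists t => //; rewrite /= in_itv /= !ltW.
have key s : line_point a b t = line_point a b s -> t = s.
  move=> [e1 e2]; apply/eqP; rewrite -subr_eq0; apply: contraNT ab => st.
  have f1 : (t - s) * (b.1 - a.1) = 0 by move: e1; lra.
  have f2 : (t - s) * (b.2 - a.2) = 0 by move: e2; lra.
  move/eqP: f1; move/eqP: f2; rewrite !mulf_eq0 (negPf st) /= !subr_eq0.
  by case: (a) (b) => [? ?] [? ?] /= /eqP-> /eqP->.
have e0 : line_point a b 0 = a by rewrite /line_point; case: (a) => ? ? /=; congr pair; ring.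
have e1 : line_point a b 1 = b by rewrite /line_point; case: (b) => ? ? /=; congr pair; ring.
case=> E; [have := key 0|have := key 1]; rewrite ?e0 ?e1 => /(_ E); lra.
Qed.

(** At an inner point both weights are positive, so strictness at one of the four ends makes [f p]
    at most and at least [t] with one strict inequality. *)
Lemma between_separated (x y t : R) a b c d p :
  let f q := x * q.1 + y * q.2 in
  f a <= t -> f b <= t -> t <= f c -> t <= f d ->
  [|| f a < t, f b < t, t < f c | t < f d] ->
  between a b p -> between c d p -> False.
Proof.
move=> f fa fb fc fd strict [s /andP[s0 s1] ps] [r /andP[r0 r1] pr].
have fs : f p = (1 - s) * f a + s * f b by rewrite ps /f /=; ring.
have fr : f p = (1 - r) * f c + r * f d by rewrite pr /f /=; ring.
by move: strict => /or4P[]; nra.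
Qed.

(** The difference of two common points is a multiple of both directions, hence zero. *)
Lemma between_det a b c d p : det (b - a) (d - c) != 0 ->
  between a b p -> between c d p -> forall p', between a b p' -> between c d p' -> p = p'.
Proof.
move=> D [s _ ps] [r _ pr] p' [s' _ ps'] [r' _ pr'].
suff E : s = s' by rewrite ps ps' E.
have e1 : (s - s') * (b.1 - a.1) = (r - r') * (d.1 - c.1).
  move: (congr1 fst ps) (congr1 fst pr) (congr1 fst ps') (congr1 fst pr') => /=; lra.
have e2 : (s - s') * (b.2 - a.2) = (r - r') * (d.2 - c.2).
  move: (congr1 snd ps) (congr1 snd pr) (congr1 snd ps') (congr1 snd pr') => /=; lra.
have : (s - s') * det (b - a) (d - c) = 0.
  rewrite /det /=.
  have -> : (s - s') * ((b.1 - a.1) * (d.2 - c.2) - (b.2 - a.2) * (d.1 - c.1)) =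
    ((s - s') * (b.1 - a.1)) * (d.2 - c.2) - ((s - s') * (b.2 - a.2)) * (d.1 - c.1) by ring.
  by rewrite e1 e2; ring.
by move/eqP; rewrite mulf_eq0 (negPf D) orbF subr_eq0 => /eqP.
Qed.

Lemma between_cross a b c d p : det (b - a) (d - c) != 0 ->
  between a b p -> between c d p -> cross_at (segment a b) (segment c d) p.
Proof.
have [v vE] : exists v, v = b - a by exists (b - a).
have [w wE] : exists w, w = d - c by exists (d - c).
rewrite -vE -wE => D0 [s s01 ps] [r r01 pr]; pose D := det v w.
(* Coordinates centred at [p] in the basis [v], [w], by Cramer's rule; [k] is the inverse map. *)
pose h q : plane := (det (q - p) w / D, det v (q - p) / D).
pose k q : plane := (p.1 + q.1 * v.1 + q.2 * w.1, p.2 + q.1 * v.2 + q.2 * w.2).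
have Dn : D != 0 by [].
have hk q : h (k q) = q.
  rewrite /h /k /det /=; case: q => q1 q2 /=.
  by congr pair; rewrite /D /det in Dn *; field.
have kh q : k (h q) = q.
  rewrite /h /k /det /=; case: q => q1 q2 /=.
  by rewrite [RHS]surjective_pairing /=; congr pair; rewrite /D /det in Dn *; field.
have hc : continuous h.
  have -> : h = fun q : plane =>
     (w.2 / D * q.1 + - w.1 / D * q.2 + (p.2 * w.1 - p.1 * w.2) / D,
      - v.2 / D * q.1 + v.1 / D * q.2 + (p.1 * v.2 - p.2 * v.1) / D).
    by apply/funext=> q; rewrite /h /det /=; congr pair; field.
  by apply: pair_continuous; exact: affine_continuous.
have kc : continuous k.
  have -> : k = fun q : plane => (v.1 * q.1 + w.1 * q.2 + p.1, v.2 * q.1 + w.2 * q.2 + p.2).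
    by apply/funext=> q; rewrite /k; congr pair; ring.
  by apply: pair_continuous; exact: affine_continuous.
(* In this box the parameters on both segments stay strictly between 0 and 1, so each segment fills
   its whole axis. *)
pose B : set plane := (fst @^-1` `]- s, 1 - s[) `&` (snd @^-1` `]- r, 1 - r[).
have oB : open B.
  apply: openI; apply: open_comp; try exact: interval_open; move=> q _; [exact: cvg_fst|exact: cvg_snd].
have hU : h @` (h @^-1` B) = B.
  by apply/seteqP; split=> [_ [q Bq <-] //|q Bq]; exists (k q); rewrite /= ?hk.
have hp : h p = (0, 0) by rewrite /h /det !subrr /=; congr pair; ring.
exists (h @^-1` B), h, k; split.
- split; first by apply: open_comp oB => q _; exact: hc.
  rewrite /= hp /B /= !in_itv /=; move: s01 r01; lra.
- by rewrite hU.
- by split=> [||q _]; [exact: continuous_subspaceT|exact: continuous_subspaceT|exact: kh].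
- exact: hp.
move=> q Bq; have [h1 h2] : - s < (h q).1 < 1 - s /\ - r < (h q).2 < 1 - r.
  by move: Bq; rewrite /preimage /B /= !in_itv.
have ks t : k (t, 0) = line_point a b (s + t).
  by rewrite /k ps /line_point vE /=; congr pair; ring.
have kr t : k (0, t) = line_point c d (r + t).
  by rewrite /k pr /line_point wE /=; congr pair; ring.
have hs t : h (line_point a b t) = (t - s, 0).
  by rewrite -(hk (t - s, 0)) ks subrKC.
have hr t : h (line_point c d t) = (0, t - r).
  by rewrite -(hk (0, t - r)) kr subrKC.
have in01 (x y : R) : - x < y < 1 - x -> x + y \in `[0, 1] by rewrite in_itv /=; lra.
split; split.
- by case=> t _ <-; rewrite hs.
- move=> h0; exists (s + (h q).1); first exact: in01.
  by rewrite -ks -[RHS]kh; congr k; rewrite [RHS]surjective_pairing h0.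
- by case=> t _ <-; rewrite hr.
- move=> h0; exists (r + (h q).2); first exact: in01.
  by rewrite -kr -[RHS]kh; congr k; rewrite [RHS]surjective_pairing h0.
Qed.

Lemma between_exists a b c d :
  let D := det (b - a) (d - c) in
  0 < det (c - a) (d - c) * D < D ^+ 2 -> 0 < det (c - a) (b - a) * D < D ^+ 2 ->
  exists2 p, between a b p & between c d p.
Proof.
move=> D /andP[s0 s1] /andP[r0 r1].
have Dn : D != 0 by apply: contraTneq s0 => ->; rewrite mulr0 ltxx.
have D2 : 0 < D ^+ 2 by rewrite exprn_even_gt0.
have quo n : 0 < n * D -> n * D < D ^+ 2 -> 0 < n / D < 1.
  move=> n0 n1; rewrite -[n / D]mulr1 -(divff Dn) mulrACA -invfM -expr2.
  by rewrite divr_gt0 //= ltr_pdivrMr // divff // mul1r.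
exists (line_point a b (det (c - a) (d - c) / D)).
  by exists (det (c - a) (d - c) / D); first exact: quo.
exists (det (c - a) (b - a) / D); first exact: quo.
rewrite /line_point; congr pair; rewrite /D /det /= in Dn *; field; exact: Dn.
Qed.

End Segments.

(** * The drawing of the graphs and its crossings *)

Section RealDrawing.
Variable R : realType.

Definition zreal (z : Z) : R := (int_of_Z z)%:~R.

Lemma zrealD x y : zreal (x + y)%Z = zreal x + zreal y.
Proof. by rewrite /zreal -intrD -rmorphD. Qed.

Lemma zrealM x y : zreal (x * y)%Z = zreal x * zreal y.
Proof. by rewrite /zreal -intrM -rmorphM. Qed.

Lemma zrealB x y : zreal (x - y)%Z = zreal x - zreal y.
Proof. by rewrite /zreal -intrB -rmorphB. Qed.

Lemma zreal_lt x y : (x < y)%Z -> zreal x < zreal y.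
Proof.
move=> xy; rewrite -subr_gt0 -zrealB /zreal ltr0z.
have : (0 < y - x)%Z by lia.
by case: (y - x)%Z => [|p|p] //= _; rewrite ltz_nat; lia.
Qed.

Lemma zreal_le x y : (x <= y)%Z -> zreal x <= zreal y.
Proof. by move/Z.lt_eq_cases=> [/zreal_lt/ltW//|->]. Qed.

Lemma zreal_inj : injective zreal.
Proof. by move=> x y /eqP; rewrite eqr_int => /eqP/(can_inj int_of_ZK). Qed.

Definition zpoint (q : Z * Z) : R * R := (zreal q.1, zreal q.2).

Lemma zpoint_inj : injective zpoint.
Proof. by move=> [a b] [c d] [/zreal_inj-> /zreal_inj->]. Qed.

Lemma zsep_between a b c d p : zsep a b c d ->
  between (zpoint a) (zpoint b) p -> between (zpoint c) (zpoint d) p -> False.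
Proof.
move=> [n [t [ha hb hc hd st]]].
have E q : zreal n.1 * (zpoint q).1 + zreal n.2 * (zpoint q).2 = zreal (zdot n q).
  by rewrite /zdot zrealD !zrealM.
apply: (@between_separated _ (zreal n.1) (zreal n.2) (zreal t));
  rewrite ?E; [exact: zreal_le|exact: zreal_le|exact: zreal_le|exact: zreal_le|].
by case: st => [/zreal_lt->|[/zreal_lt->|[/zreal_lt->|/zreal_lt->]]]; rewrite ?orbT.
Qed.

Lemma det_zpoint a b c d :
  det (zpoint b - zpoint a) (zpoint d - zpoint c) = zreal (zdet (zsub b a) (zsub d c)).
Proof. by rewrite /det /zdet /= !(zrealB, zrealM). Qed.

Variable m : nat.

Definition straight_layout : layout R (cluster_graph m) :=
  Layout (fun x : cluster_graph m => zpoint (zpos x))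
         (fun x y : cluster_graph m => segment (zpoint (zpos x)) (zpoint (zpos y))).

Lemma edge_between u v p : edge_interior straight_layout u v p ->
  between (zpoint (zpos u)) (zpoint (zpos v)) p.
Proof. exact: segment_interior. Qed.

(** A common interior point rules out separation, leaving the second alternative of [compatible]. *)
Lemma crossing_mate u v x y p : crossing_point straight_layout u v x y p ->
  [/\ edge_ends x y = edge_ends (G := cluster_graph m) (mate u v).1 (mate u v).2, disjoint_edges u v x y
    & det (zpoint (zpos v) - zpoint (zpos u)) (zpoint (zpos y) - zpoint (zpos x)) != 0].
Proof.
move=> [uv xy ne /edge_between pu /edge_between px].
have [/zsep_between/(_ pu px)//|[e d z]] := edge_compatible uv xy ne.
split=> //; rewrite det_zpoint; apply/eqP; rewrite -[0]/(zreal 0%Z).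
by move/zreal_inj.
Qed.

Lemma edge_interior_ends u v x y : edge_ends u v = edge_ends x y ->
  edge_interior straight_layout u v = edge_interior straight_layout x y.
Proof.
move=> E; have sym a b : edge_interior straight_layout a b = edge_interior straight_layout b a.
  by rewrite /edge_interior /= segment_sym setUC.
have [ux|nux] := eqVneq u x.
  have [->|nvy] := eqVneq v y; first by rewrite ux.
  have : v \in edge_ends x y by rewrite -E !inE eqxx orbT.
  have : y \in edge_ends u v by rewrite E !inE eqxx orbT.
  rewrite !inE (negPf nvy) [y == v]eq_sym (negPf nvy) !orbF => /eqP yu /eqP vx.
  by rewrite yu vx -ux.
have : u \in edge_ends x y by rewrite -E !inE eqxx.
have : x \in edge_ends u v by rewrite E !inE eqxx.
rewrite !inE (negPf nux) [x == u]eq_sym (negPf nux) /= => /eqP-> /eqP->.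
exact: sym.
Qed.

Lemma straight_neq u v : @adj (cluster_graph m) u v -> zpoint (zpos u) != zpoint (zpos v).
Proof.
by move=> uv; apply: contraTneq uv => /zpoint_inj/zpos_inj->; rewrite adj_irrefl.
Qed.

Lemma straight_one_plane : is_one_plane straight_layout.
Proof.
split; first split.
- by move=> u v /zpoint_inj/zpos_inj.
- by move=> u v _; exact: segment_sym.
- by move=> u v /straight_neq; exact: segment_arc.
(* The vertex [w] is treated as a degenerate segment separated from the edge. *)
- move=> u v w uv wi; have wb := edge_between wi; case: wi => _ nw.
  have wu : w <> u by move=> E; apply: nw; left; rewrite E.
  have wv : w <> v by move=> E; apply: nw; right; rewrite E.
  exact: (zsep_between (vertex_edge_sep uv wu wv) wb (between_refl _)).
- move=> u v x y p cr; have [_ _ d] := crossing_mate cr.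
  by case: cr => _ _ _ /edge_between pu /edge_between px; exact: between_cross.
- move=> u v x y x' y' p p' cr cr'.
  have [E _ d] := crossing_mate cr; have [E' _ _] := crossing_mate cr'.
  have EE : edge_ends x y = edge_ends x' y' by rewrite E E'.
  split=> //; case: cr cr' => _ _ _ pu px [_ _ _ pu' px'].
  rewrite -(edge_interior_ends EE) in px'.
  exact: (between_det d (edge_between pu) (edge_between px) (edge_between pu') (edge_between px')).
- by move=> u v x y p /crossing_mate[].
Qed.

Lemma crossings_distinct :
  all (fun x : (port * port) * (port * port) => (x.1.1 != x.2.1) && (x.1.1 != x.2.2)) crossings.
Proof. by []. Qed.

(** The listed pairs really cross in the drawing, so a plane subgraph contains at most one edge of
    each. *)
Lemma crossings_exist x : x \in crossings -> exists p,
  crossing_point straight_layout (port_vertex m x.1.1) (port_vertex m x.1.2)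
    (port_vertex m x.2.1) (port_vertex m x.2.2) p.
Proof.
move=> xc.
have e1 : x.1 \in exits.
  by apply/flattenP; exists [:: x.1; x.2]; [apply/mapP; exists x|rewrite !inE eqxx].
have e2 : x.2 \in exits.
  by apply/flattenP; exists [:: x.1; x.2]; [apply/mapP; exists x|rewrite !inE eqxx orbT].
have [v1 v2 _ a1] := exit_adj m e1; have [v3 v4 _ a2] := exit_adj m e2.
have /andP[n1 n2] := allP crossings_distinct x xc.
have /and4P[] := allP crossings_cross x xc.
set D := zdet (exit_direction x.1) (exit_direction x.2).
set s := zdet _ (exit_direction x.2); set t := zdet _ (exit_direction x.1).
move=> /Z.ltb_lt s0 /Z.ltb_lt s1 /Z.ltb_lt t0 /Z.ltb_lt t1.
have r0 := scaling_gt0 m.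
have [sc0 sc1] := crossing_scale r0 s0 s1; have [tc0 tc1] := crossing_scale r0 t0 t1.
have [] := @between_exists R (zpoint (zpos (port_vertex m x.1.1)))
   (zpoint (zpos (port_vertex m x.1.2))) (zpoint (zpos (port_vertex m x.2.1)))
   (zpoint (zpos (port_vertex m x.2.2))).
- rewrite !det_zpoint !zpos_port // !zdet_scale expr2 -!zrealM -[0]/(zreal 0%Z).
  by apply/andP; split; apply: zreal_lt; [exact: sc0|exact: sc1].
- rewrite !det_zpoint !zpos_port // !zdet_scale expr2 -!zrealM -[0]/(zreal 0%Z).
  by apply/andP; split; apply: zreal_lt; [exact: tc0|exact: tc1].
move=> p pu px; exists p; split=> //.
- move=> E; have : port_vertex m x.1.1 \in edge_ends (G := cluster_graph m) (port_vertex m x.2.1) (port_vertex m x.2.2).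
    by rewrite -E !inE eqxx.
  rewrite !inE => /orP[]/eqP/port_vertex_inj H.
    by move: n1; rewrite H ?eqxx.
  by move: n2; rewrite H ?eqxx.
- by apply: between_interior pu; apply: straight_neq.
- by apply: between_interior px; apply: straight_neq.
Qed.

End RealDrawing.

Theorem theorem4 (R : realType) :
  exists G : nat -> one_plane_graph R,
    (forall i j : nat, i <> j -> ~ isomorphic (G i) (G j)) /\
    (forall i : nat,
       k_connected (@adj (G i)) 6 /\
       ~ (exists F : rel (G i),
            spanning_plane_subgraph (opg_layout (G i)) F /\ k_connected F 3)).
Proof.
exists (fun m => OnePlaneGraph (straight_one_plane R m)); split.
  move=> i j ij [f [fb _]]; apply: ij.
  (* The order [9 * (m.+2 * 6).+1] determines [m]. *)
  by have := bij_eq_card fb; rewrite !card_vertex; lia.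
move=> m; split; first exact: cluster_graph_connected.
case=> F [[Fsym Fsub Fplane] F3].
apply: (crossing_choice Fsym Fsub _ F3) => x xc; apply/negP=> /andP[f1 f2].
have [p] := crossings_exist R m xc; exact: Fplane.
Qed.
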